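(* Let $m,n\geq 1$ with $m\neq n$. Then there is no $*$-reduction from $(\mathrm{Mod}_\omega(\widehat{\mathcal{B}_m}),\simeq_{\mathrm{iso}})$ to $(\mathrm{Mod}_\omega(\widehat{\mathcal{B}_n}),\simeq_{\mathrm{iso}})$.
   Context: A map $f\colon X\to Y$ between Polish spaces is Baire measurable if preimages of open sets have the Baire property, and category preserving if preimages of meager sets are meager. A $*$-reduction from an equivalence relation $E$ on $X$ to an equivalence relation $F$ on $Y$ is a Baire measurable category preserving map $f\colon X\to Y$ such that $x\,E\,x'\iff f(x)\,F\,f(x')$ for all $x,x'\in X$. For $n\ge1$, $\mathcal{L}_n$ is the language with $n$-ary function symbols $s_i$ ($i\in\omega$) and $n$-ary relation symbols $R_j$ ($j\in\omega$). A BKL$_n$-structure is an $\mathcal{L}_n$-structure $A$ (possibly empty) such that: (B1) the relations $(R_j)_{j\in\omega}$ partition $A^n$; (B2) if $a=(a_0,\dots,a_{n-1})$ satisfies $R_j$, then $s_i(a)=a_0$ for all $i>j$; (B3) for every $B\subseteq A$ with $|B|=n+1$ there is $b\in B$ lying in the substructure generated by $B\setminus\{b\}$; (B4) $A$ is locally finite, i.e. every finitely generated substructure is finite. $\mathcal{B}_n$ is the class of all BKL$_n$-structures. Let $\widehat{\mathcal{L}_n}=\mathcal{L}_n\cup\{P_i\mid i\in\omega\}$ with $P_i$ new unary relation symbols; $\widehat{\mathcal{B}_n}$ is the class of $\widehat{\mathcal{L}_n}$-structures whose reduct to $\mathcal{L}_n$ is in $\mathcal{B}_n$ and in which no two distinct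 elements satisfy exactly the same predicates $P_i$. For a countable language $\mathcal{L}$, $\mathcal{X}_{\mathcal{L}}$ is the Polish space of all $\mathcal{L}$-structures with domain $\omega$, with subbasis the sets $\{A\mid A\models R(a)\}$, $\{A\mid A\models\lnot R(a)\}$, $\{A\mid A\models f(a)=b\}$, for $R,f$ relation and function symbols of $\mathcal{L}$, $a$ a tuple from $\omega$ of the right length and $b\in\omega$. $\mathrm{Mod}_\omega(\widehat{\mathcal{B}_n})$ is the subspace of $\mathcal{X}_{\widehat{\mathcal{L}_n}}$ of structures in $\widehat{\mathcal{B}_n}$ (it is $G_\delta$, hence Polish), and $\simeq_{\mathrm{iso}}$ is the isomorphism relation on it. *)

(* Defs.v *)
From HB Require Import structures.
From mathcomp Require Import all_boot all_classical.
From mathcomp Require Import topology.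

Set Implicit Arguments.
Unset Strict Implicit.
Unset Printing Implicit Defensive.

Local Open Scope classical_set_scope.
Local Open Scope card_scope.

Section Category.
Context {X : topologicalType}.

Definition nowhere_dense (A : set X) : Prop := (closure A)^° = set0.

Definition meager (A : set X) : Prop :=
  exists2 F : nat -> set X,
    (forall i, nowhere_dense (F i)) & A = \bigcup_i F i.

Definition Baire_property (A : set X) : Prop :=
  exists2 U : set X, open U & meager (A `+` U).

End Category.

Definition Baire_measurable {X Y : topologicalType} (f : X -> Y) : Prop :=
  forall V : set Y, open V -> Baire_property (f @^-1` V).

Definition category_preserving {X Y : topologicalType} (f : X -> Y) : Prop :=
  forall M : set Y, meager M -> meager (f @^-1` M).

Definition star_reduction {X Y : topologicalType}
    (E : X -> X -> Prop) (F : Y -> Y -> Prop) (f : X -> Y) : Prop :=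
  [/\ Baire_measurable f,
      category_preserving f &
      forall x x', E x x' <-> F (f x) (f x')].

(* Countable first-order languages; [T] may be empty in [structure L T]. *)

Record language := Language {
  fsym : countType;
  rsym : countType;
  farity : fsym -> nat;
  rarity : rsym -> nat
}.

Record structure (L : language) (T : Type) := Structure {
  fint : forall f : fsym L, (farity f).-tuple T -> T;
  rint : forall r : rsym L, set ((rarity r).-tuple T)
}.

Section Structures.
Context {L : language}.

Definition subuniverse {T : Type} (A : structure L T) (S : set T) : Prop :=
  forall (f : fsym L) (a : (farity f).-tuple T),
    (forall k, S (tnth a k)) -> S (fint A a).

Definition generated {T : Type} (A : structure L T) (S : set T) : set T :=
  smallest (subuniverse A) S.

Definition isomorphic {T U : Type}
    (A : structure L T) (B : structure L U) : Prop :=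
  exists h : T -> U,
    [/\ bijective h,
        forall (f : fsym L) (a : (farity f).-tuple T),
          h (fint A a) = fint B (map_tuple h a) &
        forall (r : rsym L) (a : (rarity r).-tuple T),
          rint A a <-> rint B (map_tuple h a)].

End Structures.

Definition structure_space (L : language) : Type := structure L nat.

Section StructureSpace.
Variable L : language.

HB.instance Definition _ := gen_eqMixin (structure_space L).
HB.instance Definition _ := gen_choiceMixin (structure_space L).

Definition structure_subbase : set (set (structure_space L)) :=
  [set U | [\/ exists (r : rsym L) (a : (rarity r).-tuple nat),
                 U = [set A | rint A a],
               exists (r : rsym L) (a : (rarity r).-tuple nat),
                 U = [set A | ~ rint A a] |
               exists (f : fsym L) (a : (farity f).-tuple nat) (b : nat),
                 U = [set A | fint A a = b]]].

HB.instance Definition _ :=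
  isSubBaseTopological.Build (structure_space L) structure_subbase id.

End StructureSpace.

(* [fint A i] interprets s_i and [rint A j] interprets R_j. *)
Definition BKL_language (n : nat) : language :=
  @Language nat nat (fun=> n) (fun=> n).

(* The R_j partition the n-tuples, with empty blocks allowed.  [ohead] avoids a
   default value for a_0; it is [None] only when n = 0. *)
Record BKL (n : nat) (T : Type) (A : structure (BKL_language n) T) : Prop := {
  BKL_partition : forall a : n.-tuple T,
    exists! j : rsym (BKL_language n), rint A (r := j) a;
  BKL_first : forall (i j : nat) (a : n.-tuple T),
    rint A (r := j : rsym (BKL_language n)) a -> j < i ->
    ohead a = Some (fint A (f := i : fsym (BKL_language n)) a);
  BKL_generation : forall B : set T, B #= `I_(n.+1) ->
    exists2 b, B b & generated A (B `\ b) b;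
  BKL_locally_finite : forall S : set T,
    finite_set S -> finite_set (generated A S)
}.

(* The predicate P_i is the symbol [inr i]. *)
Definition hat (L : language) : language :=
  @Language (fsym L) (rsym L + nat)%type (@farity L)
    (fun r => match r with inl r => rarity r | inr _ => 1 end).

Definition reduct {L : language} {T : Type} (A : structure (hat L) T) :
    structure L T :=
  @Structure L T (fun f => fint A (f := f : fsym (hat L)))
    (fun r => rint A (r := inl r : rsym (hat L))).

Definition pred_hat {L : language} {T : Type} (A : structure (hat L) T)
    (i : nat) (x : T) : Prop :=
  rint A (r := inr i : rsym (hat L)) [tuple x].

Record BKL_hat (n : nat) (T : Type) (A : structure (hat (BKL_language n)) T) :
    Prop := {
  BKL_hat_reduct : BKL (reduct A);
  BKL_hat_separated : forall x y : T,
    (forall i, pred_hat A i x <-> pred_hat A i y) -> x = y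
}.

(* As a type, this set carries the subspace topology (subtype_topology). *)
Definition Mod_omega_hat (n : nat) : set (structure_space (hat (BKL_language n))) :=
  [set A | BKL_hat A].

Arguments Mod_omega_hat n : clear implicits.

Definition iso_hat (n : nat) (A B : Mod_omega_hat n) : Prop :=
  isomorphic (val A : structure _ nat) (val B : structure _ nat).

Arguments iso_hat n A B : clear implicits.

(* Main.v *)
(* The predicates P_i label the elements of a structure by subsets of omega, and
   distinct elements have distinct labels; so isomorphic structures realize the
   same labels, and in only one way.

   Let N > M and let g be a continuous reduction from a comeager subset of a
   nonempty open set of models of arity N to models of arity M.  A fusion argument
   shows that an element of g(A) is determined by a finite closed part Y of A
   together with finitely much information on Y: all generic re-enumerations of A
   fixing Y put that element in the same place.  If no label in g(A) really
   depends on such a part, all generic A have isomorphic images, a contradiction.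
   Otherwise place M+1 disjoint copies Y_t of Y in one structure A so that the
   union of any family of the Y_t is closed; this is possible since M+1 <= N.
   They determine elements b_t of g(A), and (B3) in g(A) puts some b_i in the
   substructure generated by the other b_j.  So b_i is determined both by Y_i and
   by the union of the other Y_j, which is disjoint from Y_i; amalgamating two
   extensions of A in which Y_i decides the label of b_i differently, over that
   union, is a contradiction.

   A *-reduction from arity m to arity n is continuous on a comeager set, which
   settles m > n.  If m < n, category preservation makes its image nonmeager, so
   it has a continuous right inverse on a comeager subset of a nonempty open set,
   which is a reduction in the other direction. *)
From HB Require Import structures.
Require Import Defs.
From mathcomp Require Import all_boot all_classical.
From mathcomp Require Import topology.

Set Implicit Arguments.
Unset Strict Implicit.
Unset Printing Implicit Defensive.

Local Open Scope classical_set_scope.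
Local Open Scope card_scope.

(** * Structures on the natural numbers *)

Notation hatstr N := (structure (hat (BKL_language N)) nat).

Section Basics.
Context {N : nat}.
Implicit Types (A B : hatstr N) (a : N.-tuple nat) (F : seq nat).

Definition opS A (i : nat) a : nat := fint A (f := i : Defs.fsym (hat (BKL_language N))) a.
Definition relR A (j : nat) a : Prop :=
  rint A (r := inl j : rsym (hat (BKL_language N))) a.

Definition mkstr (s : nat -> N.-tuple nat -> nat) (r : nat -> N.-tuple nat -> Prop)
    (p : nat -> nat -> Prop) : hatstr N :=
  @Structure (hat (BKL_language N)) nat s
    (fun x => match x return set ((rarity (x : rsym (hat (BKL_language N)))).-tuple nat) with
       | inl j => [set a | r j a]
       | inr i => [set a : 1.-tuple nat | p i (thead a)] end).

Lemma opS_mk s r p i a : opS (mkstr s r p) i a = s i a. Proof. by []. Qed.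
Lemma relR_mk s r p j a : relR (mkstr s r p) j a = r j a. Proof. by []. Qed.
Lemma pred_mk s r p i x : pred_hat (mkstr s r p) i x = p i x. Proof. by []. Qed.

Lemma tuple1_thead (a : 1.-tuple nat) : a = [tuple thead a].
Proof. by apply/val_inj; case/tupleP: a => x t; rewrite (tuple0 t). Qed.

Lemma hatstr_ext A B : (forall i a, opS A i a = opS B i a) ->
  (forall j a, relR A j a <-> relR B j a) ->
  (forall i x, pred_hat A i x <-> pred_hat B i x) -> A = B.
Proof.
case: A B => [sA rA] [sB rB] hS hR hP.
have -> : sA = sB.
  by apply: functional_extensionality_dep => i; apply/funext => a; apply: hS.
suff -> : rA = rB by [].
apply: functional_extensionality_dep => -[j|i]; apply/seteqP; split => a /=.
- by move/(hR j a).
- by move/(hR j a).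
- by rewrite (tuple1_thead a) => /(hP i (thead a)).
- by rewrite (tuple1_thead a) => /(hP i (thead a)).
Qed.

(** The generated substructure as an induction principle: a property of all generated elements is
    proved by taking it for [E]. *)
Definition op_gen A (S : set nat) : set nat := fun x => forall E : set nat,
  S `<=` E -> (forall i a, (forall y, y \in a -> E y) -> E (opS A i a)) -> E x.

Lemma generatedE A S : generated (reduct A) S = op_gen A S.
Proof.
have e (E : set nat) : subuniverse (reduct A) E <->
    (forall i a, (forall y, y \in a -> E y) -> E (opS A i a)).
  split=> h i a ha; apply: h .
    by move=> k; apply: ha; apply: mem_tnth.
  by move=> y /tnthP[k ->]; exact: ha.
apply/seteqP; split => x hx E.
- by move=> SE cE; apply: hx; split=> //; apply/e.
- by case=> /e cE SE; apply: hx.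
Qed.

Definition op_closed A F := forall i a, {subset a <= F} -> opS A i a \in F.

Definition separates A := forall x y : nat,
  (forall i, pred_hat A i x <-> pred_hat A i y) -> x = y.

Lemma op_gen_seq A F : finite_set (op_gen A [set` F]) ->
  exists E, [/\ {subset F <= E}, op_closed A E & forall x, x \in E -> op_gen A [set` F] x].
Proof.
move=> /finite_seqP[E EE]; exists E; split.
- move=> x xF; have : op_gen A [set` F] x by move=> U + _; apply.
  by rewrite EE.
- move=> i a aE; have : op_gen A [set` F] (opS A i a).
    move=> U FU cU; apply: (cU) => y /aE yE.
    by have h : [set` E] y by []; rewrite -EE in h; exact: (h U FU cU).
  by rewrite EE.
- by move=> x xE; have : [set` E] x by []; rewrite -EE.
Qed.

Lemma op_gen_closed A F (S : set nat) x : op_closed A F -> (forall y, S y -> y \in F) ->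
  op_gen A S x -> x \in F.
Proof.
move=> cF SF /(_ [set` F]); apply; first exact: SF.
by move=> i a ha; apply: cF => y /ha.
Qed.

Lemma op_gen_mono A (S S' : set nat) x : S `<=` S' -> op_gen A S x -> op_gen A S' x.
Proof. by move=> SS' h E S'E; apply: h => y /SS'/S'E. Qed.

Hypothesis N_gt0 : 0 < N.

Lemma ohead_head a : ohead a = Some (head 0 a).
Proof. by case: a => [[|x s] i] //=; move: i N_gt0; rewrite /= => /eqP <-. Qed.

Lemma card_seq (s : seq nat) : uniq s -> [set` s] #= `I_(size s).
Proof.
move=> us; apply/card_set_bijP; exists (index^~ s); split.
- by move=> x /= xs; rewrite index_mem.
- by move=> x y /set_mem xs /set_mem ys e; rewrite -(nth_index 0 xs) e nth_index.
- move=> i /= ilt; exists (nth 0 s i); first exact: mem_nth.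
  by rewrite index_uniq.
Qed.

(** Finite sets become lists: (B3) is tested on duplicate-free lists, and (B4) says that every list
    lies in a closed one. As N is positive, the default in [head 0] is never reached. *)
Lemma BKL_hatP A : BKL_hat A <->
  [/\ forall a, exists! j, relR A j a,
      forall i j a, relR A j a -> j < i -> opS A i a = head 0 a,
      forall B : seq nat, uniq B -> size B = N.+1 ->
        exists2 b, b \in B & op_gen A [set x | x \in B /\ x <> b] b,
      forall F, exists2 E, {subset F <= E} & op_closed A E &
      separates A].
Proof.
have setE (B : seq nat) b : [set` B] `\ b = [set x | x \in B /\ x <> b].
  by apply/seteqP; split => x [].
split=> [[[b1 b2 b3 b4] sep]|[b1 b2 b3 b4 sep]]; split=> //.
- move=> i j a aR ji; have := b2 i j a aR ji.
  by rewrite ohead_head => -[].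
- move=> B uB sB; have [|b bB] := b3 [set` B]; first by rewrite -sB card_seq.
  by rewrite generatedE setE => gb; exists b.
- move=> F; have := b4 _ (finite_seq F); rewrite generatedE => /op_gen_seq[E [FE cE _]].
  by exists E.
- split=> //.
  + by move=> i j a aR ji; rewrite ohead_head; congr Some; apply/esym/(b2 i j a).
  + move=> B cB; have : finite_set B by apply/finite_setP; exists N.+1.
    move=> /finite_seqP[s0 B0]; have {}B0 : B = [set` undup s0].
      by rewrite B0; apply/seteqP; split=> x /=; rewrite mem_undup.
    rewrite B0 in cB *; have us := undup_uniq s0; move: (undup s0) us cB => s us cB.
    have sN : size s = N.+1.
      by apply/card_eq_II; apply: card_eq_trans _ cB; rewrite card_eq_sym card_seq.
    by have [b bs gb] := b3 s us sN; exists b; rewrite // generatedE setE.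
  + move=> S /finite_seqP[F ->]; have [E FE cE] := b4 F.
    apply: (sub_finite_set _ (finite_seq E)) => x; rewrite generatedE.
    exact: op_gen_closed.
Qed.
End Basics.

(** * The topology of the space of models *)

Section Topology.
Context {N : nat}.
Hypothesis N_gt0 : 0 < N.
Notation X := (set_type (@Mod_omega_hat N)).
Implicit Types (A B : X) (a : N.-tuple nat) (F : seq nat) (K : nat).

Lemma hat_rel A a : exists! j, relR (val A) j a.
Proof. by case: A => A /= /set_mem /(BKL_hatP N_gt0)[]. Qed.

Lemma hat_first A i j a : relR (val A) j a -> j < i -> opS (val A) i a = head 0 a.
Proof. by case: A => A /= /set_mem /(BKL_hatP N_gt0)[_ h _ _ _]; exact: h. Qed.

Lemma hat_gen A (B : seq nat) : uniq B -> size B = N.+1 ->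
  exists2 b, b \in B & op_gen (val A) [set x | x \in B /\ x <> b] b.
Proof. by case: A => A /= /set_mem /(BKL_hatP N_gt0)[_ _ h _ _]; exact: h. Qed.

Lemma hat_finite A F : exists2 E, {subset F <= E} & op_closed (val A) E.
Proof. by case: A => A /= /set_mem /(BKL_hatP N_gt0)[_ _ _ h _]; exact: h. Qed.

Lemma hat_sep A : separates (val A).
Proof. by case: A => A /= /set_mem /(BKL_hatP N_gt0)[_ _ _ _ h]; exact: h. Qed.

Lemma hat_rel_inj A j k a : relR (val A) j a -> relR (val A) k a -> j = k.
Proof. by case: (hat_rel A a) => i [_ u] /u <- /u <-. Qed.

Definition agree (A B : hatstr N) F K :=
  [/\ forall i a, {subset a <= F} -> opS A i a = opS B i a,
      forall j a, {subset a <= F} -> (relR A j a <-> relR B j a) &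
      forall i x, i < K -> x \in F -> (pred_hat A i x <-> pred_hat B i x)].

Definition atom : Type :=
  ((nat * N.-tuple nat * nat) + (bool * nat * N.-tuple nat) + (bool * nat * nat))%type.

HB.instance Definition _ := Countable.on atom.

Definition holds (A : hatstr N) (t : atom) : Prop :=
  match t with
  | inl (inl (i, a, b)) => opS A i a = b
  | inl (inr (v, j, a)) => if v then relR A j a else ~ relR A j a
  | inr (v, i, x) => if v then pred_hat A i x else ~ pred_hat A i x
  end.

Lemma subbase_open (U : set (structure_space (hat (BKL_language N)))) :
  structure_subbase U -> open U.
Proof.
move=> sU; exists [set U].
  by move=> _ ->; apply: (@finI_from1 _ _ _ id).
by rewrite bigcup_set1.
Qed.

Lemma near_holds A t : holds (val A) t -> nbhs A [set B : X | holds (val B) t].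
Proof.
move=> hA; have oW : open [set B : structure_space (hat (BKL_language N)) | holds B t].
  apply: subbase_open; case: t hA => [[[[i a] b]|[[v j] a]]|[[v i] x]] _.
  - by apply: Or33; exists (i : Defs.fsym (hat (BKL_language N))), a, b.
  - case: v; [apply: Or31|apply: Or32];
      by exists (inl j : rsym (hat (BKL_language N))), a.
  - case: v; [apply: Or31|apply: Or32];
      by exists (inr i : rsym (hat (BKL_language N))), [tuple x].
exists (val @^-1` [set B : structure_space (hat (BKL_language N)) | holds B t]).
by split => //; exists [set B : structure_space (hat (BKL_language N)) | holds B t].
Qed.

Lemma subbase_atom (U : set (structure_space (hat (BKL_language N)))) :
  structure_subbase U -> exists t, U = [set B | holds B t].
Proof.
case=> [[r [a ->]]|[r [a ->]]|[i [a [b ->]]]].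
- case: r a => [j|i] a; first by exists (inl (inr (true, j, a))).
  by exists (inr (true, i, thead a)); rewrite {1}(tuple1_thead a).
- case: r a => [j|i] a; first by exists (inl (inr (false, j, a))).
  by exists (inr (false, i, thead a)); rewrite {1}(tuple1_thead a).
- by exists (inl (inl (i, a, b))).
Qed.

Lemma nbhs_atoms A (V : set X) : nbhs A V ->
  exists w : seq atom, (forall t, t \in w -> holds (val A) t) /\
    forall B, (forall t, t \in w -> holds (val B) t) -> V B.
Proof.
case=> _ [[W [D' D'sub <-] <-] [I D'I IA] WV].
have [E Esub EI] := D'sub _ D'I.
pose S := structure_space (hat (BKL_language N)).
pose s : seq (set S) := finmap.enum_fset E.
have {}Esub U : U \in s -> structure_subbase U by move=> /Esub/set_mem.
have {}EI x : I x <-> forall U, U \in s -> U x by rewrite -EI.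
have /choice[f fE] : forall U, exists t, U \in s -> U = [set B | holds B t].
  move=> U; have [UE|] := boolP (U \in s); last by exists (inr (true, 0, 0)).
  by have [t ->] := subbase_atom (Esub _ UE); exists t.
exists [seq f U | U <- s]; split.
  move=> t /mapP[U Us ->]; have /EI/(_ U Us) : I (val A) by exact: IA.
  by rewrite {1}(fE U Us).
move=> B hB; apply: WV => /=; exists I => //.
suff : I (val B) by []. apply/EI => U Us.
by rewrite (fE U Us) /=; apply: hB; apply: map_f.
Qed.
End Topology.

Section Agree.
Context {N : nat}.
Implicit Types (A B C : hatstr N) (a : N.-tuple nat) (F : seq nat) (K : nat).

Lemma agree_refl A F K : agree A A F K. Proof. by []. Qed.

Lemma agree_sym A B F K : agree A B F K -> agree B A F K.
Proof.
case=> s r p; split=> [i a /s ->|j a /r <-|i x /p h /h <-] //.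
Qed.

Lemma agree_trans B A C F K : agree A B F K -> agree B C F K -> agree A C F K.
Proof.
move=> [s r p] [s' r' p']; split=> [i a aF|j a aF|i x iK xF].
- by rewrite s ?s'.
- by rewrite r ?r'.
- by rewrite p ?p'.
Qed.

Lemma agree_sub A B F K F' K' : {subset F' <= F} -> K' <= K ->
  agree A B F K -> agree A B F' K'.
Proof.
move=> FF KK [s r p]; split=> [i a aF|j a aF|i x iK xF].
- by apply: s => x /aF/FF.
- by apply: r => x /aF/FF.
- by apply: p; [apply: leq_trans KK|apply: FF].
Qed.

Lemma agree_op_closed A B F K : agree A B F K -> op_closed A F -> op_closed B F.
Proof. by case=> s _ _ cA i a aF; rewrite -s //; apply: cA. Qed.

Lemma finite_tuples F : exists L : seq (N.-tuple nat),
  forall a, {subset a <= F} -> a \in L.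
Proof.
exists (map (map_tuple (fun i : 'I_(size F) => nth 0 F i)) (enum {: N.-tuple 'I_(size F)})).
move=> a aF; case: (posnP (size F)) => [F0|F0].
  have a0 : size a = 0.
    apply/eqP; rewrite -leqn0 leqNgt -has_predT; apply/hasP => -[x /aF].
    by rewrite (size0nil F0).
  apply/mapP; rewrite size_tuple in a0; subst N.
  exists [tuple]; first by rewrite mem_enum.
  by apply/val_inj; rewrite /= (tuple0 a).
apply/mapP; exists (map_tuple (fun x => insubd (Ordinal F0) (index x F)) a).
  by rewrite mem_enum.
apply/eq_from_tnth => k; rewrite !tnth_map val_insubd index_mem.
by rewrite aF ?mem_tnth // nth_index // aF ?mem_tnth.
Qed.
End Agree.

Section Topology.
Context {N : nat}.
Hypothesis N_gt0 : 0 < N.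
Notation X := (set_type (@Mod_omega_hat N)).
Implicit Types (A B : X) (a : N.-tuple nat) (F : seq nat) (K : nat).

Lemma nbhs_all (T : topologicalType) (I : eqType) (x : T) (s : seq I)
    (P : I -> set T) :
  (forall i, i \in s -> nbhs x (P i)) ->
  nbhs x [set y | forall i, i \in s -> P i y].
Proof.
elim: s => [|i s IH] h; first by apply: filterS filterT => y _ i.
have := h i (mem_head _ _).
have {IH} := IH (fun j js => h j (mem_behead (s := i :: s) js)).
apply: filterS2 => y hs hi j; rewrite inE => /orP[/eqP->|/hs] //.
Qed.

(** If R_j holds at a tuple, (B1) excludes the other R_k and (B2) fixes s_i for i > j. So finitely
    many open conditions decide all operations and relations R_k at that tuple; only the predicates
    P_i need the bound [K]. *)
Lemma near_agree A F K : nbhs A [set B : X | agree (val A) (val B) F K].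
Proof.
have [L LF] := finite_tuples (N := N) F.
have h1 : nbhs A [set B : X | forall a, a \in L ->
  [set B : X | (forall i, opS (val A) i a = opS (val B) i a) /\
    (forall j, relR (val A) j a <-> relR (val B) j a)] B].
  apply: nbhs_all => a _; have [j [jA _]] := hat_rel N_gt0 A a.
  have n1 := @near_holds N A (inl (inr (true, j, a))) jA.
  have n2 : nbhs A [set B : X | forall i, i \in iota 0 j.+1 ->
     [set B : X | opS (val B) i a = opS (val A) i a] B].
    apply: nbhs_all => i _.
    exact: (@near_holds N A (inl (inl (i, a, opS (val A) i a)))).
  apply: filterS2 n1 n2 => B jB iB; split=> [i|k].
    have [ij|ji] := leqP i j; first by rewrite iB // mem_iota.
    by rewrite (hat_first N_gt0 jA ji) (hat_first N_gt0 jB ji).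
  split=> [kA|kB]; first by rewrite -(hat_rel_inj N_gt0 jA kA).
  by rewrite -(hat_rel_inj N_gt0 jB kB).
have h2 : nbhs A [set B : X | forall ix, ix \in [seq (i, x) | i <- iota 0 K, x <- F] ->
   [set B : X | pred_hat (val A) ix.1 ix.2 <-> pred_hat (val B) ix.1 ix.2] B].
  apply: nbhs_all => -[i x] _ /=; have [h|h] := pselect (pred_hat (val A) i x).
    apply: filterS (@near_holds N A (inr (true, i, x)) h) => B hB.
    by split.
  by apply: filterS (@near_holds N A (inr (false, i, x)) h) => B hB.
apply: filterS2 h1 h2 => B hB1 hB2; split=> [i a aF|j a aF|i x iK xF].
- by have [] := hB1 a (LF a aF).
- by have [] := hB1 a (LF a aF).
- by apply: (hB2 (i, x)); apply/allpairsP; exists (i, x); rewrite mem_iota.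
Qed.

Definition atom_supp (t : atom (N := N)) : seq nat :=
  match t with
  | inl (inl (i, a, b)) => a
  | inl (inr (v, j, a)) => a
  | inr (v, i, x) => [:: x] end.

(** One more than the index of a predicate, since [agree] compares P_i only for i < K. *)
Definition atom_idx (t : atom (N := N)) : nat :=
  match t with
  | inl _ => 0
  | inr (v, i, x) => i.+1 end.

Lemma agree_holds (A B : hatstr N) F K t : agree A B F K ->
  {subset atom_supp t <= F} -> atom_idx t <= K -> holds A t -> holds B t.
Proof.
case: t => [[[[i a] b]|[[v j] a]]|[[v i] x]] [s r p] /= tF tK.
- by rewrite s.
- by case: v => /=; rewrite r.
- by case: v => /=; rewrite p //; apply: tF; rewrite inE.
Qed.

Lemma nbhs_agree A (V : set X) : nbhs A V ->
  exists F K, op_closed (val A) F /\ forall B, agree (val A) (val B) F K -> V B.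
Proof.
move=> /nbhs_atoms[w [wA wV]].
have [F wF cF] := hat_finite N_gt0 A (flatten [seq atom_supp t | t <- w]).
exists F, (\max_(t <- w) atom_idx t); split=> // B AB; apply: wV => t tw.
apply: agree_holds AB _ _ (wA t tw); last exact: leq_bigmax_seq.
by move=> x xt; apply: wF; apply/flattenP; exists (atom_supp t) => //; apply: map_f.
Qed.

End Topology.

(** * Permutations of the universe *)

Section Permutations.

(* A countable family of permutations extending every finite injection; countability
   keeps the set of structures all of whose translates are generic comeager. *)
Definition swap (c : nat * nat) (z : nat) : nat :=
  if z == c.1 then c.2 else if z == c.2 then c.1 else z.

Lemma swapK c : involutive (swap c).
Proof.
case: c => x y z; rewrite /swap /=; case: (eqVneq z x) => [->|zx].
  by case: (eqVneq y x) => [->|_] //; rewrite eqxx.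
case: (eqVneq z y) => [->|zy]; first by rewrite eqxx.
by rewrite (negbTE zx) (negbTE zy).
Qed.

Definition swaps (s : seq (nat * nat)) (z : nat) : nat := foldr swap z s.

Lemma swaps_cat s t z : swaps (s ++ t) z = swaps s (swaps t z).
Proof. by rewrite /swaps foldr_cat. Qed.

Lemma swaps_revK s : cancel (swaps s) (swaps (rev s)).
Proof.
elim: s => [|c s IH] z //; rewrite rev_cons -cats1 swaps_cat.
by rewrite [swaps [:: c] _]/= /swaps /= swapK; apply: IH.
Qed.

Lemma swaps_rev s : cancel (swaps (rev s)) (swaps s).
Proof. by rewrite -{2}[s]revK; apply: swaps_revK. Qed.

Lemma swaps_inj s : injective (swaps s). Proof. exact: can_inj (swaps_revK s). Qed.

(** Induction on [F]: one more transposition sends the current image of the new point to its target.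
    By injectivity it disturbs no value fixed before. *)
Lemma swaps_extend (f : nat -> nat) (F : seq nat) : {in F &, injective f} ->
  exists s, {in F, swaps s =1 f}.
Proof.
elim: F => [|x F IH] fi; first by exists [::].
have [|s sf] := IH; first by move=> y z yF zF; apply: fi; rewrite inE ?yF ?zF orbT.
exists ((swaps s x, f x) :: s) => y; rewrite inE => /orP[/eqP->|yF].
  by rewrite /swaps /= -/(swaps s x) /swap /= eqxx.
have [->|yx] := eqVneq y x; first by rewrite /swaps /= -/(swaps s x) /swap /= eqxx.
rewrite /swaps /= -/(swaps s x) -/(swaps s y) /swap /=.
case: eqP => [/swaps_inj /eqP|_]; first by rewrite (negbTE yx).
rewrite (sf y yF); case: eqP => // /fi fyx.
by rewrite fyx ?eqxx ?inE ?yF ?eqxx ?orbT // in yx.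
Qed.

End Permutations.

Section Action.
Context {N : nat}.
Implicit Types (A B C : hatstr N) (a : N.-tuple nat) (F : seq nat) (K : nat).
Implicit Types p q : nat -> nat.

(** The image of [A] under [p], with [q] meant as the inverse of [p]: arguments are pulled back by
    [q], values pushed forward by [p]. *)
Definition act (p q : nat -> nat) A : hatstr N :=
  @Structure (hat (BKL_language N)) nat
    (fun f (a : (farity f).-tuple nat) => p (fint A (map_tuple q a)))
    (fun r => [set a : (rarity r).-tuple nat | rint A (map_tuple q a)]).

Lemma opS_act p q A i a : opS (act p q A) i a = p (opS A i (map_tuple q a)).
Proof. by []. Qed.

Lemma relR_act p q A j a : relR (act p q A) j a = relR A j (map_tuple q a).
Proof. by []. Qed.

Lemma pred_act p q A i x : pred_hat (act p q A) i x = pred_hat A i (q x).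
Proof. by rewrite /pred_hat /=; congr (rint A _); apply/val_inj. Qed.

Lemma map_tupleK n p q (a : n.-tuple nat) : cancel p q -> map_tuple q (map_tuple p a) = a.
Proof. by move=> pK; apply/val_inj; rewrite /= (mapK pK). Qed.

Lemma act_comp p q p' q' A : act p q (act p' q' A) = act (p \o p') (q' \o q) A.
Proof.
apply: hatstr_ext => [i a|j a|i x]; rewrite ?opS_act ?relR_act ?pred_act //;
by rewrite (_ : map_tuple q' (map_tuple q a) = map_tuple (q' \o q) a) //;
   apply/val_inj; rewrite /= -map_comp.
Qed.

Lemma act_id A : act id id A = A.
Proof.
by apply: hatstr_ext => [i a|j a|i x]; rewrite ?opS_act ?relR_act ?pred_act //;
  rewrite (_ : map_tuple id a = a) //; apply/val_inj; rewrite /= map_id.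
Qed.

Lemma act_isomorphic p q A : cancel p q -> cancel q p ->
  isomorphic A (act p q A).
Proof.
move=> pK qK; exists p; split; first by exists q.
- by move=> f a /=; rewrite map_tupleK.
- by move=> r a /=; rewrite map_tupleK.
Qed.

Lemma op_gen_act p q A (S S' : set nat) x : cancel p q -> S `<=` p @^-1` S' ->
  op_gen A S x -> op_gen (act p q A) S' (p x).
Proof.
move=> pK SS g E S'E cE; apply: (g (p @^-1` E)); first by move=> y /SS /S'E.
move=> i a aE; have := cE i (map_tuple p a).
rewrite opS_act map_tupleK //; apply => y /mapP[z za ->]; exact: aE.
Qed.

Lemma op_closed_act p q A F : cancel p q -> op_closed A F -> op_closed (act p q A) (map p F).
Proof.
move=> pK cF i a aF; rewrite opS_act; apply: map_f; apply: cF => y /mapP[z /aF].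
by case/mapP=> w wF -> ->; rewrite pK.
Qed.

Lemma act_hat p q A : 0 < N -> cancel p q -> cancel q p ->
  BKL_hat A -> BKL_hat (act p q A).
Proof.
move=> N0 pK qK /(BKL_hatP N0)[b1 b2 b3 b4 sep]; apply/(BKL_hatP N0); split.
- by move=> a; have [j jP] := b1 (map_tuple q a); exists j.
- move=> i j a; rewrite relR_act opS_act => /b2 h /h ->.
  by case: a {h} => -[|x s] /= /eqP <- // in N0 *.
- move=> B uB sB; have [||b /mapP[c cB ->] gb] := b3 (map q B).
  + by rewrite map_inj_uniq //; apply: can_inj qK.
  + by rewrite size_map.
  + exists c => //; rewrite -[c in X in op_gen _ _ X]qK.
    apply: op_gen_act gb => // y [/mapP[d dB ->] dc] /=.
    by rewrite qK; split=> // cd; apply: dc; rewrite cd.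
- move=> F; have [E FE cE] := b4 (map q F).
  exists (map p E); last exact: op_closed_act.
  by move=> x xF; rewrite -[x]qK; apply/map_f/FE/map_f.
- move=> x y h; apply: (can_inj qK); apply: sep => i.
  by have := h i; rewrite !pred_act.
Qed.

(** Closedness of [F] keeps the values of operations where [p] and [p'] coincide. *)
Lemma agree_act p q p' q' A B F K : cancel p q -> cancel p' q' ->
  {in F, p =1 p'} -> op_closed A F -> agree A B F K ->
  agree (act p q A) (act p' q' B) (map p F) K.
Proof.
move=> pK pK' pp cF [s r pr].
have qq a : {subset a <= map p F} -> map_tuple q a = map_tuple q' a.
  move=> aF; apply/eq_from_tnth => k; rewrite !tnth_map.
  have /mapP[z zF ->] := aF _ (mem_tnth k a).
  by rewrite pK pp // pK'.
have qF a : {subset a <= map p F} -> {subset map_tuple q a <= F}.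
  by move=> aF x /mapP[y /aF /mapP[z zF ->] ->]; rewrite pK.
split=> [i a aF|j a aF|i x iK /mapP[z zF ->]].
- by rewrite !opS_act -qq // s ?pp //; [rewrite -s; [apply: cF|]|]; apply: qF.
- by rewrite !relR_act -qq // r //; apply: qF.
- by rewrite !pred_act pK pp // pK' pr.
Qed.

End Action.

Section ActX.
Context {N : nat}.
Hypothesis N_gt0 : 0 < N.
Notation X := (set_type (@Mod_omega_hat N)).
Implicit Types (A B : X) (F : seq nat) (K : nat) (s t : seq (nat * nat)).

Definition mkX (A : hatstr N) (hA : BKL_hat A) : X := exist _ A (mem_set hA).

Lemma actX_subproof s A : BKL_hat (act (swaps s) (swaps (rev s)) (val A)).
Proof. by apply: act_hat (swaps_revK s) (swaps_rev s) _ => //; apply/set_mem/valP. Qed.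

Definition actX s A : X := mkX (actX_subproof s A).

Lemma actX_cat s t A : actX (s ++ t) A = actX s (actX t A).
Proof.
apply/val_inj; rewrite /= act_comp; congr act; apply/funext => x /=.
  by rewrite swaps_cat.
by rewrite rev_cat swaps_cat.
Qed.

Lemma actX_id s A : swaps s =1 id -> actX s A = A.
Proof.
move=> sid; apply/val_inj; rewrite /= -[RHS]act_id; congr act; apply/funext => x.
  exact: sid.
by rewrite -{1}(sid x) swaps_revK.
Qed.

Lemma actXK s : cancel (actX s) (actX (rev s)).
Proof. by move=> A; rewrite -actX_cat actX_id // => x; rewrite swaps_cat swaps_revK. Qed.

Lemma actKX s : cancel (actX (rev s)) (actX s).
Proof. by move=> A; rewrite -actX_cat actX_id // => x; rewrite swaps_cat swaps_rev. Qed.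

Lemma iso_actX s A : iso_hat N A (actX s A).
Proof. by apply: act_isomorphic; [apply: swaps_revK|apply: swaps_rev]. Qed.

Lemma agree_actX s t A B F K : {in F, swaps s =1 swaps t} -> op_closed (val A) F ->
  agree (val A) (val B) F K ->
  agree (val (actX s A)) (val (actX t B)) (map (swaps s) F) K.
Proof. by apply: agree_act; apply: swaps_revK. Qed.

Lemma op_closed_actX s A F : op_closed (val A) F -> op_closed (val (actX s A)) (map (swaps s) F).
Proof. by apply: op_closed_act; apply: swaps_revK. Qed.

Lemma map_swaps_revK s F : map (swaps (rev s)) (map (swaps s) F) = F.
Proof. exact: mapK (swaps_revK s) F. Qed.

Lemma agree_actX_rev s A B F K : op_closed (val A) F ->
  agree (val (actX s A)) (val B) (map (swaps s) F) K ->
  agree (val A) (val (actX (rev s) B)) F K.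
Proof.
move=> cA /(agree_actX (s := rev s) (t := rev s)).
by rewrite actXK map_swaps_revK; apply => //; apply: op_closed_actX.
Qed.

Lemma near_actX s A (V : set X) : nbhs (actX s A) V -> nbhs A (actX s @^-1` V).
Proof.
move=> nV.
have [F0 [K [cF0 FV]]] := nbhs_agree N_gt0 nV.
have cF : op_closed (val A) (map (swaps (rev s)) F0).
  by rewrite -[A in val A](actXK s); apply: op_closed_actX.
apply: filterS (near_agree N_gt0 A (map (swaps (rev s)) F0) K) => B AB.
apply: FV; have := agree_actX (s := s) (t := s) (fun _ _ => erefl) cF AB.
by rewrite (mapK (swaps_rev s)).
Qed.

End ActX.

Section Iso.
Context {L : language}.

Lemma isomorphic_sym (T U : Type) (A : structure L T) (B : structure L U) :
  isomorphic A B -> isomorphic B A.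
Proof.
move=> [h [[g hK gK] hf hr]]; exists g.
have mK n (a : n.-tuple U) : map_tuple h (map_tuple g a) = a.
  by apply/val_inj; rewrite /= (mapK gK).
split; first by exists h.
- by move=> f a; apply: (can_inj hK); rewrite gK hf mK.
- by move=> r a; rewrite hr mK.
Qed.

End Iso.

(** * Extending and amalgamating finite structures *)

Lemma seq_max (s : seq nat) : s <> [::] ->
  exists2 x, x \in s & forall y, y \in s -> y <= x.
Proof.
elim: s => // x [|y s] IH _.
  by exists x; rewrite ?mem_head // => z; rewrite inE => /eqP->.
have [//|m ms mM] := IH.
have [xm|mx] := leqP x m.
  by exists m; [rewrite inE ms orbT|move=> z; rewrite inE => /orP[/eqP->//|/mM]].
exists x; rewrite ?mem_head // => z; rewrite inE => /orP[/eqP->//|/mM].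
by move=> zm; apply: leq_trans zm (ltnW mx).
Qed.

Section Fill.
Context {N : nat}.
Hypothesis N_gt0 : 0 < N.
Notation X := (set_type (@Mod_omega_hat N)).
Implicit Types (A B C G : hatstr N) (a : N.-tuple nat) (F : seq nat) (K : nat).

Lemma rem_tuple (B : seq nat) b : uniq B -> size B = N.+1 -> b \in B ->
  exists a, forall x, (x \in a) = (x \in B) && (x != b).
Proof.
move=> uB sB bB; have h : size (rem b B) == N by rewrite size_rem // sB.
exists (Tuple h) => x; transitivity (x \in rem b B) => //; rewrite (mem_rem_uniq b uB).
by rewrite inE andbC.
Qed.

Lemma op_gen_agree A C F (S : set nat) x : op_closed A F ->
  (forall i a, {subset a <= F} -> opS A i a = opS C i a) ->
  (forall y, S y -> y \in F) -> op_gen A S x -> op_gen C S x.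
Proof.
move=> cF AC SF g E SE cE.
have [//|i a aE|//] := g (fun y => E y /\ y \in F).
  by move=> y Sy; split; [apply: SE|apply: SF].
have aF : {subset a <= F} by move=> y /aE[].
split; last exact: cF.
by rewrite AC //; apply: cE => y /aE[].
Qed.

Lemma mem_head_tuple a : head 0 a \in a.
Proof. by case: a => -[|x s] /= i; rewrite ?inE ?eqxx //; move: i N_gt0 => /eqP <-. Qed.

(* (B1)-(B3) restricted to [T]; (B4) is automatic on a finite closed set. *)
Definition piece_on A (T : set nat) : Prop :=
  [/\ forall a, (forall x, x \in a -> T x) -> exists! j, relR A j a,
      forall i j a, (forall x, x \in a -> T x) -> relR A j a -> j < i ->
        opS A i a = head 0 a &
      forall B : seq nat, (forall x, x \in B -> T x) -> uniq B -> size B = N.+1 ->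
        exists2 b, b \in B & op_gen A [set x | x \in B /\ x <> b] b].

Definition piece A F := piece_on A [set` F] /\ op_closed A F.

Lemma piece_X (A : X) F : op_closed (val A) F -> piece (val A) F.
Proof.
split=> //; split=> [a _|i j a _|B _].
- exact: hat_rel.
- exact: (hat_first N_gt0 (A := A)).
- exact: hat_gen.
Qed.

(* Outside [D] a tuple generates [cl a]; this is what makes (B3) hold when pieces
   are put together. *)
Definition fill G (D : N.-tuple nat -> bool) (cl : N.-tuple nat -> pred nat)
    (bd : N.-tuple nat -> nat) (p : nat -> nat -> Prop) : hatstr N :=
  mkstr (fun i a => if D a then opS G i a else if cl a i then i else head 0 a)
    (fun j a => if D a then relR G j a else j = bd a) p.

(** Outside [D] the operation s_x returns x itself for x in [cl a], and [bd a] bounds [cl a], whence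
    (B2). For (B3), a set either lies in a closed part governed by [G] or contains a tuple outside
    [D] that generates the missing element. *)
Lemma fill_piece G (D : N.-tuple nat -> bool) (cl : N.-tuple nat -> pred nat)
    (bd : N.-tuple nat -> nat) (p : nat -> nat -> Prop) (T : set nat) :
  (forall a, D a -> (forall x, x \in a -> T x) ->
     (exists! j, relR G j a) /\
     (forall i j, relR G j a -> j < i -> opS G i a = head 0 a)) ->
  (forall a x, ~~ D a -> cl a x -> x <= bd a) ->
  (forall B : seq nat, (forall x, x \in B -> T x) -> uniq B -> size B = N.+1 ->
    (exists F, [/\ op_closed G F, (forall a, {subset a <= F} -> D a), {subset B <= F} &
       exists2 b, b \in B & op_gen G [set x | x \in B /\ x <> b] b]) \/
    (exists b a, [/\ b \in B, {subset a <= B}, b \notin a, ~~ D a & cl a b])) ->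
  piece_on (fill G D cl bd p) T.
Proof.
move=> h1 h2 h3; split.
- move=> a aT; have [Da|nD] := boolP (D a).
    have [[j [jR ju]] _] := h1 a Da aT; exists j.
    by split; [rewrite relR_mk Da|move=> k; rewrite relR_mk Da; apply: ju].
  exists (bd a); split; first by rewrite relR_mk (negbTE nD).
  by move=> k; rewrite relR_mk (negbTE nD).
- move=> i j a aT; rewrite relR_mk opS_mk; have [Da|nD] := boolP (D a).
    by have [_ h] := h1 a Da aT; apply: h.
  move=> -> ji; case: ifP => // /(h2 a i nD); by rewrite leqNgt ji.
- move=> B BT uB sB; have [] := h3 B BT uB sB.
    move=> [F [cF DF BF [b bB gb]]]; exists b => //.
    apply: op_gen_agree cF _ _ gb; last by move=> y [/BF].
    by move=> i a aF; rewrite opS_mk DF.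
  move=> [b [a [bB aB ba nD clb]]]; exists b => // E BE cE.
  have := cE b a; rewrite opS_mk (negbTE nD) clb; apply => y ya.
  by apply: BE; split; [apply: aB|move=> yb; rewrite yb (negbTE ba) in ya].
Qed.

(* Outside [F], a tuple generates [F] and everything up to its largest entry not in
   [F]. *)
Lemma realize A F K : piece A F -> exists C : X, agree A (val C) F K.
Proof.
move=> [[b1 b2 b3] cF].
pose D a := all [in F] a.
have DP a : reflect {subset a <= F} (D a) by apply: allP.
pose mx a := \max_(x <- a | x \notin F) x.
pose cl a : pred nat := fun i => (i \in F) || (i <= mx a).
pose bd a := maxn (mx a) (\max_(x <- F) x).
(* From index K on, P_(K+x) holds of x alone; this separates points and leaves the predicates below
   [K] unchanged. *)
pose p i x := if i < K then pred_hat A i x else i = K + x.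
pose C := fill A D cl bd p.
have maxF x : x \in F -> x <= \max_(x <- F) x by move=> xF; apply: leq_bigmax_seq.
have maxa a x : x \in a -> x \notin F -> x <= mx a.
  by move=> xa xF; apply: leq_bigmax_seq.
have [c1 c2 c3] : piece_on C setT.
  apply: fill_piece.
  - by move=> a /DP aF _; split=> [|i j]; [apply: b1|apply: b2].
  - move=> a x _ /orP[/maxF|] h; rewrite /bd leq_max h ?orbT //.
  - move=> B _ uB sB; have [BF|] := boolP (all [in F] B).
      left; exists F; split=> //; first by move=> a /DP.
        exact/allP.
      by apply: b3 => //; apply/allP.
    move=> BF; right.
    (* The largest entry x outside [F] is kept and any other b dropped: b lies in [F] or below x, so
       the remaining tuple generates it. *)
    have [|x] := @seq_max [seq y <- B | y \notin F].
      move=> e; move: BF; rewrite -has_predC; move/hasP => -[y yB yF].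
      have : y \in [::] by rewrite -e mem_filter yB andbT.
      by rewrite in_nil.
    rewrite mem_filter => /andP[xF xB] xmax.
    have [b bB bx] : exists2 b, b \in B & b != x.
      case: B uB sB {BF xB xmax} => [|y [|z B]] //=; first by case: N N_gt0.
      rewrite inE negb_or => /andP[/andP[yz _] _] _.
      have [yx|yx] := eqVneq y x; last by exists y; rewrite ?mem_head.
      by exists z; rewrite ?inE ?eqxx ?orbT // -yx eq_sym.
    have [a aB] := rem_tuple uB sB bB.
    have xa : x \in a by rewrite aB xB eq_sym.
    exists b, a; split=> //.
    + by move=> y; rewrite aB => /andP[].
    + by rewrite aB eqxx andbF.
    + by apply/negP => /DP /(_ x xa); rewrite (negbTE xF).
    + rewrite /cl; have [//|bF /=] := boolP (b \in F).
      by apply: leq_trans (maxa a x xa xF); apply: xmax; rewrite mem_filter bF.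
have hC : BKL_hat C.
  apply/(BKL_hatP N_gt0); split.
  - by move=> a; apply: c1.
  - by move=> i j a; apply: c2.
  - by move=> B; apply: c3.
  (* An initial segment of omega together with [F] is closed. *)
  - move=> H; exists (F ++ iota 0 (\max_(x <- H) x).+1).
      by move=> x xH; rewrite mem_cat mem_iota add0n ltnS leq_bigmax_seq // orbT.
    move=> i a aH; rewrite opS_mk; case: ifP => [/DP aF|_].
      by rewrite mem_cat cF.
    case: ifP => [|_]; last exact/aH/mem_head_tuple.
    rewrite mem_cat mem_iota add0n ltnS => /orP[->//|imx].
    apply/orP; right; apply: leq_trans imx _; apply/bigmax_leqP_seq => x xa xF.
    by have := aH x xa; rewrite mem_cat (negbTE xF) mem_iota add0n ltnS.
  - move=> x y h; have := h (K + x); rewrite !pred_mk /p ltnNge leq_addr /=.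
    by move=> [/(_ erefl)] /addnI.
exists (mkX hC); have -> : val (mkX hC) = C by []; split.
- by move=> i a aF; rewrite opS_mk ifT //; apply/DP.
- by move=> j a aF; rewrite relR_mk ifT //; apply/DP.
- by move=> i x iK xF; rewrite pred_mk /p iK.
Qed.

End Fill.

(** * Free amalgams and disjoint unions *)

Section Amalgams.
Context {N : nat}.
Hypothesis N_gt0 : 0 < N.
Notation X := (set_type (@Mod_omega_hat N)).
Implicit Types (a : N.-tuple nat) (F H : seq nat) (K : nat).

(* The free amalgam: a tuple contained in neither piece generates everything, which
   satisfies (B3) as soon as tuples have at least two entries. *)
Lemma amalgam (A B : X) F H K : 1 < N ->
  op_closed (val A) F -> op_closed (val B) H ->
  agree (val A) (val B) [seq x <- F | x \in H] 0 ->
  exists C : X, [/\ op_closed (val C) (F ++ H), agree (val A) (val C) F K &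
    forall E L, {subset E <= H} -> L <= K ->
      (forall i x, i < L -> x \in E -> x \in F ->
        (pred_hat (val A) i x <-> pred_hat (val B) i x)) ->
      agree (val B) (val C) E L].
Proof.
move=> N1 cA cB [AB_S AB_R _].
have inI a : {subset a <= F} -> {subset a <= H} -> {subset a <= [seq x <- F | x \in H]}.
  by move=> aF aH x xa; rewrite mem_filter aH // aF.
have [[a1 a2 a3] _] := piece_X N_gt0 cA; have [[b1 b2 b3] _] := piece_X N_gt0 cB.
pose G := mkstr (fun i a => if all [in F] a then opS (val A) i a else opS (val B) i a)
  (fun j a => if all [in F] a then relR (val A) j a else relR (val B) j a)
  (fun=> fun=> True).
pose D a := all [in F] a || all [in H] a.
(* On the overlap the predicates come from [A]; agreement with [B] is therefore claimed only where
   the predicates of both match. *)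
pose p i x := if x \in F then pred_hat (val A) i x else pred_hat (val B) i x.
pose C := fill G D (fun=> [in F ++ H]) (fun=> \max_(x <- F ++ H) x) p.
have GA_S i a : {subset a <= F} -> opS G i a = opS (val A) i a.
  by move=> /allP aF; rewrite opS_mk aF.
have GA_R j a : {subset a <= F} -> relR G j a = relR (val A) j a.
  by move=> /allP aF; rewrite relR_mk aF.
have GB_S i a : {subset a <= H} -> opS G i a = opS (val B) i a.
  by move=> aH; rewrite opS_mk; case: allP => // aF; apply: AB_S; apply: inI.
have GB_R j a : {subset a <= H} -> relR G j a <-> relR (val B) j a.
  by move=> aH; rewrite relR_mk; case: allP => // aF; apply: AB_R; apply: inI.
have DF a : {subset a <= F} -> D a by move=> /allP aF; rewrite /D aF.
have DH a : {subset a <= H} -> D a by move=> /allP aH; rewrite /D aH orbT.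
have CA : agree (val A) C F 0.
  split=> [i a aF|j a aF|//].
  - by rewrite opS_mk DF // GA_S.
  - by rewrite relR_mk DF // GA_R.
have CB : agree (val B) C H 0.
  split=> [i a aH|j a aH|//].
  - by rewrite opS_mk DH // GB_S.
  - by rewrite relR_mk DH //; apply: iff_sym; apply: GB_R.
have cC : op_closed C (F ++ H).
  move=> i a aFH; rewrite opS_mk /D mem_cat.
  case: ifP => [/orP[/allP aF|/allP aH]|_].
  - by rewrite GA_S // cA.
  - by rewrite GB_S // cB ?orbT.
  by case: ifP => [|_]; rewrite -mem_cat //; apply/aFH/mem_head_tuple.
have pC : piece C (F ++ H).
  split=> //; apply: fill_piece.
  - move=> a /orP[/allP aF|/allP aH] _.
      split=> [|i j]; last by rewrite GA_R // GA_S //; apply: a2.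
      by have [j [jA ju]] := a1 a aF; exists j; split; [|move=> k];
        rewrite GA_R //; apply: ju.
    split=> [|i j]; last by rewrite GB_R // GB_S //; apply: b2.
    have [j [jA ju]] := b1 a aH; exists j; split; first by apply/GB_R.
    by move=> k /(GB_R _ _ aH); apply: ju.
  - by move=> _ x _ xFH; apply: leq_bigmax_seq.
  - move=> B0 B0FH uB sB; have [/allP BF|nBF] := boolP (all [in F] B0).
      left; exists F; split=> //; first by move=> i a aF; rewrite GA_S // cA.
      have [b bB gb] := a3 B0 BF uB sB; exists b => //.
      by apply: op_gen_agree cA _ _ gb => [i a aF|y [/BF]//]; rewrite GA_S.
    have [/allP BH|nBH] := boolP (all [in H] B0).
      left; exists H; split=> //; first by move=> i a aH; rewrite GB_S // cB.
      have [b bB gb] := b3 B0 BH uB sB; exists b => //.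
      by apply: op_gen_agree cB _ _ gb => [i a aH|y [/BH]//]; rewrite GB_S.
    right; move: nBF nBH; rewrite -!has_predC.
    move=> /hasP[x xB /= xF] /hasP[y yB /= yH].
    (* N+1 > 2 leaves a third element b; dropping it keeps x outside [F] and y outside [H], so the
       remaining tuple is outside [D]. *)
    have [b bB /andP[bx by']] : exists2 b, b \in B0 & (b != x) && (b != y).
      apply/hasP; apply: contraT; rewrite -all_predC => /allP h.
      have := uniq_leq_size uB (s2 := [:: x; y]); rewrite sB /= => h'.
      have : N.+1 <= 2; last by rewrite leqNgt ltnS N1.
      by apply: h' => z /h /=; rewrite negb_and !negbK !inE.
    have [a aB] := rem_tuple uB sB bB; exists b, a; split=> //.
    + by move=> z; rewrite aB => /andP[].
    + by rewrite aB eqxx andbF.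
    + rewrite /D negb_or; apply/andP; split; apply/allPn.
        by exists x; rewrite // aB xB eq_sym.
      by exists y; rewrite // aB yB eq_sym.
    + exact: B0FH.
have FFH x : x \in F -> x \in F ++ H by rewrite mem_cat => ->.
have [E CE] := realize N_gt0 K pC; exists E; split.
- exact: (agree_op_closed CE).
- case: CA CE => [s r _] [s' r' p'].
  split=> [i a aF|j a aF|i x iK xF].
  + by rewrite s // s' // => x /aF/FFH.
  + by rewrite r // r' // => x /aF/FFH.
  + by rewrite -p' ?FFH // pred_mk /p xF.
- move=> W L WH LK hp; case: CB CE => [s r _] [s' r' p'].
  have HFH x : x \in H -> x \in F ++ H by rewrite mem_cat orbC => ->.
  split=> [i a aW|j a aW|i x iL xW].
  + by rewrite s ?s' // => x /aW/WH // /HFH.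
  + by rewrite r ?r' // => x /aW/WH // /HFH.
  + rewrite -p' ?HFH ?WH //; last exact: leq_trans LK.
    by rewrite pred_mk /p; case: ifP => // xF; apply: iff_sym; apply: hp.
Qed.

(* A tuple generates the union of the copies it meets.  Among N+1 elements of k <= N
   copies two lie in the same one, and removing either does not change the set of
   copies that are met. *)
Lemma disjoint_copies (k : nat) (A : 'I_k -> X) (Y : 'I_k -> seq nat) K :
  k <= N -> (forall t, op_closed (val (A t)) (Y t)) ->
  (forall s t x, x \in Y s -> x \in Y t -> s = t) ->
  exists C : X, (forall t, agree (val (A t)) (val C) (Y t) K) /\
    forall (J : pred 'I_k) (W : seq nat),
      (forall x, x \in W <-> exists2 t, J t & x \in Y t) -> op_closed (val C) W.
Proof.
move=> kN cY dY.
have pY t := piece_X N_gt0 (cY t).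
pose T := flatten [seq Y t | t <- enum 'I_k].
have TP x : x \in T <-> exists t, x \in Y t.
  split=> [/flattenP[_ /mapP[t _ ->] xt]|[t xt]]; first by exists t.
  by apply/flattenP; exists (Y t) => //; apply: map_f; rewrite mem_enum.
pose tag x := [pick t | x \in Y t].
have tagE t x : x \in Y t -> tag x = Some t.
  by move=> xt; rewrite /tag; case: pickP => [s xs|/(_ t)];
    [rewrite (dY _ _ _ xs xt)|rewrite xt].
pose G := mkstr
  (fun i a => if tag (head 0 a) is Some t then opS (val (A t)) i a else 0)
  (fun j a => if tag (head 0 a) is Some t then relR (val (A t)) j a else False)
  (fun=> fun=> True).
pose D a := [exists t, all [in Y t] a].
have DP a : reflect (exists t, {subset a <= Y t}) (D a).
  by apply: (iffP existsP) => -[t /allP h]; exists t => //; apply/allP.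
pose cl a : pred nat := fun x => [exists t, (x \in Y t) && has [in Y t] a].
have clP a x : reflect (exists t y, [/\ x \in Y t, y \in a & y \in Y t]) (cl a x).
  apply: (iffP existsP) => [[t /andP[xt /hasP[y ya yt]]]|[t [y [xt ya yt]]]].
    by exists t, y.
  by exists t; rewrite xt; apply/hasP; exists y.
pose p i x := if tag x is Some t then pred_hat (val (A t)) i x else False.
pose C := fill G D cl (fun=> \max_(x <- T) x) p.
have G_S t i a : {subset a <= Y t} -> opS G i a = opS (val (A t)) i a.
  by move=> aF; rewrite opS_mk (tagE t) //; apply/aF/mem_head_tuple.
have G_R t j a : {subset a <= Y t} -> relR G j a = relR (val (A t)) j a.
  by move=> aF; rewrite relR_mk (tagE t) //; apply/aF/mem_head_tuple.
have CA t : agree (val (A t)) C (Y t) K.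
  split=> [i a aY|j a aY|i x _ xY].
  - by rewrite opS_mk ifT ?(G_S t) //; apply/DP; exists t.
  - by rewrite relR_mk ifT ?(G_R t) //; apply/DP; exists t.
  - by rewrite pred_mk /p (tagE t).
have cC (J : pred 'I_k) (W : seq nat) :
    (forall x, x \in W <-> exists2 t, J t & x \in Y t) -> op_closed C W.
  move=> WP i a aW; rewrite opS_mk; case: ifP => [/DP[t aY]|_].
    have /aW/WP[s Js hs] := mem_head_tuple N_gt0 a.
    have st := dY _ _ _ hs (aY _ (mem_head_tuple N_gt0 a)); subst s.
    by apply/WP; exists t; rewrite // (G_S t) // cY.
  case: ifP => [/clP[t [y [it /aW/WP[s Js ys] yt]]]|_]; last exact/aW/mem_head_tuple.
  by apply/WP; exists t; rewrite // -(dY _ _ _ ys yt).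
have pC : piece C T.
  split; last first.
    apply: (cC predT) => x; split=> [/TP[t xt]|[t _ xt]]; first by exists t.
    by apply/TP; exists t.
  apply: fill_piece.
  - move=> a /DP[t aY] _; have [[a1 a2 _] _] := pY t.
    split=> [|i j]; last by rewrite (G_R t) // (G_S t) //; apply: a2.
    by have [j [jA ju]] := a1 a aY; exists j; split; [|move=> l];
      rewrite (G_R t) //; apply: ju.
  - move=> a x _ /clP[t [_ [xt _ _]]]; apply: leq_bigmax_seq => //.
    by apply/TP; exists t.
  - move=> B BT uB sB.
    have [[t BY]|nBY] := pselect (exists t, {subset B <= Y t}).
      left; exists (Y t); split=> //.
      + by move=> i a aY; rewrite (G_S t) // cY.
      + by move=> a aY; apply/DP; exists t.
      + have [[_ _ a3] _] := pY t; have [b bB gb] := a3 B BY uB sB; exists b => //.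
        by apply: op_gen_agree (cY t) _ _ gb => [i a aY|y [/BY]//]; rewrite (G_S t).
    right.
    have [b [b' [t [bB bB' bb' bt bt']]]] : exists b b' t,
        [/\ b \in B, b' \in B, b != b', b \in Y t & b' \in Y t].
      have /uniqPn : ~~ uniq (map tag B).
        apply/negP => u; have := uniq_leq_size u (s2 := [seq Some t | t <- enum 'I_k]).
        rewrite !size_map sB -enumT size_enum_ord => h.
        have : N < k; last by rewrite ltnNge kN.
        apply: h => _ /mapP[x /BT/TP[t xt] ->]; rewrite (tagE t) //.
        by apply: map_f; rewrite mem_enum.
      move=> /(_ None)[i [j [ij]]]; rewrite size_map => jB.
      rewrite !(nth_map 0) //; last exact: ltn_trans jB.
      have iB := ltn_trans ij jB.
      have /BT/TP[t it] := mem_nth 0 iB; have /BT/TP[s js] := mem_nth 0 jB.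
      rewrite (tagE t) // (tagE s) // => -[ts]; subst s.
      exists (nth 0 B i), (nth 0 B j), t; split=> //; try exact: mem_nth.
      by rewrite nth_uniq // neq_ltn ij.
    have [a aB] := rem_tuple uB sB bB; exists b, a; split=> //.
    + by move=> z; rewrite aB => /andP[].
    + by rewrite aB eqxx andbF.
    + apply/DP => -[s aY]; apply: nBY; exists t => x xB.
      have [->//|xb] := eqVneq x b.
      have xs : x \in Y s by apply: aY; rewrite aB xB.
      have b's : b' \in Y s by apply: aY; rewrite aB bB' eq_sym.
      by rewrite (dY _ _ _ bt' b's).
    + by apply/clP; exists t, b'; rewrite aB bB' eq_sym bb'.
have [E CE] := realize N_gt0 K pC; exists E; split=> [t|J W WP].
- apply: agree_trans (CA t) _; apply: agree_sub CE => // x xt.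
  by apply/TP; exists t.
- apply: (agree_op_closed (K := K) _ (cC J W WP)); apply: agree_sub CE => //.
  by move=> x /WP[t _ xt]; apply/TP; exists t.
Qed.

End Amalgams.

(** * Generic structures *)

Section Fusion.
Context {N : nat}.
Hypothesis N_gt0 : 0 < N.
Notation X := (set_type (@Mod_omega_hat N)).
Implicit Types (A B : X) (a : N.-tuple nat) (F : seq nat) (K : nat).

(* A condition is a basic open set of pairs (A, A') where A' is the image of A by a
   permutation, of which finitely many values are prescribed. *)
Record condition := Condition {
  cond_str : X; cond_dom : seq nat; cond_level : nat;
  cond_perm : seq (nat * nat);
  cond_closed : op_closed (val cond_str) cond_dom }.
Implicit Types c d : condition.

Definition cond_le c' c := [/\ {subset cond_dom c <= cond_dom c'}, cond_level c <= cond_level c',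
  agree (val (cond_str c)) (val (cond_str c')) (cond_dom c) (cond_level c) &
  {in cond_dom c, swaps (cond_perm c) =1 swaps (cond_perm c')}].

Definition realizes c A := agree (val (cond_str c)) (val A) (cond_dom c) (cond_level c).

Definition realizes_image c A :=
  agree (val (actX N_gt0 (cond_perm c) (cond_str c))) (val A)
    (map (swaps (cond_perm c)) (cond_dom c)) (cond_level c).

Lemma cond_le_refl c : cond_le c c. Proof. by split. Qed.

Lemma cond_le_trans d c e : cond_le d c -> cond_le e d -> cond_le e c.
Proof.
move=> [f k a s] [f' k' a' s']; split.
- by move=> x /f/f'.
- exact: leq_trans k'.
- by apply: agree_trans a _; apply: agree_sub a'.
- by move=> x xF; rewrite s // s' // f.
Qed.

(** Lets a condition freeze predicates that separate its domain, so that separation survives in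
    limits. *)
Lemma separating_bound A F : exists K, forall x y, x \in F -> y \in F -> x <> y ->
  exists2 i, i < K & ~ (pred_hat (val A) i x <-> pred_hat (val A) i y).
Proof.
have /choice[f fP] : forall z : nat * nat, exists i, z.1 <> z.2 ->
    ~ (pred_hat (val A) i z.1 <-> pred_hat (val A) i z.2).
  move=> [x y] /=; have [xy|xy] := pselect (x = y); first by exists 0.
  have /existsNP[i iP] : ~ forall i, pred_hat (val A) i x <-> pred_hat (val A) i y.
    by move=> /(hat_sep N_gt0)/xy.
  by exists i.
exists (\max_(z <- [seq (x, y) | x <- F, y <- F]) f z).+1 => x y xF yF xy.
exists (f (x, y)); last exact: (fP (x, y)).
by rewrite ltnS; apply: leq_bigmax_seq => //; apply/allpairsP; exists (x, y).
Qed.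

(** Every number enters the domains and every predicate is eventually frozen, so the chain
    determines one structure. Each axiom of the limit is inherited from a stage containing the
    elements concerned. *)
Lemma limit (A_ : nat -> X) (F_ : nat -> seq nat) (K_ : nat -> nat) :
  (forall n, op_closed (val (A_ n)) (F_ n)) ->
  (forall n m, n <= m -> [/\ {subset F_ n <= F_ m}, K_ n <= K_ m &
     agree (val (A_ n)) (val (A_ m)) (F_ n) (K_ n)]) ->
  (forall n, n \in F_ n.+1) -> (forall n, n <= K_ n.+1) ->
  (forall n x y, x \in F_ n.+1 -> y \in F_ n.+1 -> x <> y ->
    exists2 i, i < K_ n.+1 &
      ~ (pred_hat (val (A_ n.+1)) i x <-> pred_hat (val (A_ n.+1)) i y)) ->
  exists A : X, forall n, agree (val (A_ n)) (val A) (F_ n) (K_ n).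
Proof.
move=> clF mono F_S K_S c_sep.
have c_in n m : n < m -> n \in F_ m by move=> /mono[+ _ _]; apply.
have c_K n m : n < m -> n <= K_ m.
  by move=> /mono[_ + _]; apply: leq_trans.
have agr n m : n <= m -> agree (val (A_ n)) (val (A_ m)) (F_ n) (K_ n).
  by move=> /mono[].
pose st (a : seq nat) := (\max_(x <- a) x).+1.
have st_in (a : seq nat) x : x \in a -> x < st a.
  by move=> xa; rewrite ltnS; apply: leq_bigmax_seq.
(* Values are read at a stage where all entries are in the domain. For P_i at x the stage must
   exceed i+1 as well as x, because only predicates strictly below the level are frozen. *)
pose Ainf := mkstr (fun i a => opS (val (A_ (st a))) i a)
  (fun j a => relR (val (A_ (st a))) j a)
  (fun i x => pred_hat (val (A_ (maxn i x).+2)) i x).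
have Ain n : agree (val (A_ n)) Ainf (F_ n) (K_ n).
  have sta a : {subset a <= F_ (st a)} by move=> x /st_in/c_in.
  split=> [i a aF|j a aF|i x iK xF].
  - rewrite opS_mk; have [s1 _ _] := agr _ _ (leq_maxl n (st a)).
    have [s2 _ _] := agr _ _ (leq_maxr n (st a)).
    by rewrite s1 // s2 //; apply: sta.
  - rewrite relR_mk; have [_ s1 _] := agr _ _ (leq_maxl n (st a)).
    have [_ s2 _] := agr _ _ (leq_maxr n (st a)).
    by rewrite s1 // s2 //; apply: sta.
  - rewrite pred_mk; have [_ _ s1] := agr _ _ (leq_maxl n (maxn i x).+2).
    have [_ _ s2] := agr _ _ (leq_maxr n (maxn i x).+2).
    rewrite s1 // s2 //; last by apply: c_in; rewrite ltnS ltnW // ltnS leq_maxr.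
    by apply: (@c_K i.+1); rewrite !ltnS leq_maxl.
have hA : BKL_hat Ainf.
  apply/(BKL_hatP N_gt0); split.
  - by move=> a; have := hat_rel N_gt0 (A_ (st a)) a.
  - by move=> i j a; rewrite relR_mk opS_mk; apply: (hat_first N_gt0).
  - move=> B uB sB; have [b bB gb] := hat_gen N_gt0 (A_ (st B)) uB sB.
    exists b => //; have [s _ _] := Ain (st B).
    refine (op_gen_agree (@clF (st B)) s _ gb) => y [/st_in/c_in] //.
  - move=> F; exists (F_ (st F)); first by move=> x /st_in/c_in.
    by apply: agree_op_closed (Ain (st F)) _; apply: clF.
  - move=> x y h; apply: contrapT => xy.
    have xF : x \in F_ (maxn x y).+1 by apply: c_in; rewrite ltnS leq_maxl.
    have yF : y \in F_ (maxn x y).+1 by apply: c_in; rewrite ltnS leq_maxr.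
    have [i iK] := c_sep (maxn x y) x y xF yF xy; apply.
    by have [_ _ p] := Ain (maxn x y).+1; rewrite p // p.
exists (mkX hA); exact: Ain.
Qed.

(** A descending chain of conditions passes below each [D t]. Its structures converge by [limit],
    and its finite partial permutations converge to a bijection carrying [A] to [A']. *)
Lemma fusion (T : countType) (D : T -> condition -> Prop) c0 :
  (forall t c, exists2 c', cond_le c' c & D t c') ->
  exists A A', [/\ iso_hat N A A', realizes c0 A, realizes_image c0 A' &
    forall t, exists c, [/\ D t c, cond_le c c0, realizes c A & realizes_image c A']].
Proof.
move=> Dd.
have /choice[stp stpP] : forall cn : condition * nat, exists c', [/\ cond_le c' cn.1,
    [/\ cn.2 \in cond_dom c', cn.2 \in map (swaps (cond_perm c')) (cond_dom c') &
       cn.2 <= cond_level c'],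
    (forall x y, x \in cond_dom c' -> y \in cond_dom c' -> x <> y ->
      exists2 i, i < cond_level c' &
        ~ (pred_hat (val (cond_str c')) i x <-> pred_hat (val (cond_str c')) i y)) &
    (forall t, unpickle cn.2 = Some t -> exists d, [/\ D t d, cond_le c' d & cond_le d cn.1])].
  move=> [c n] /=.
  have [d dc dD] : exists2 d, cond_le d c & forall t, unpickle n = Some t -> D t d.
    case: (unpickle n) => [t|]; last by exists c; first exact: cond_le_refl.
    by have [d dc dD] := Dd t c; exists d => // _ [<-].
  (* Both n and its preimage under the current permutation enter the domain, so the limit map is
     total and onto. *)
  have [F Fsub cFc] := hat_finite N_gt0 (cond_str d)
    (cond_dom d ++ [:: n; swaps (rev (cond_perm d)) n]).
  have [K KP] := separating_bound (cond_str d) F.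
  have dF x : x \in cond_dom d -> x \in F by move=> xF; apply: Fsub; rewrite mem_cat xF.
  pose c' := @Condition (cond_str d) F (maxn (cond_level d) (maxn n K)) (cond_perm d) cFc.
  have c'd : cond_le c' d by split=> //; rewrite leq_max leqnn.
  exists c'; split.
  - exact: cond_le_trans c'd.
  - split; first by apply: Fsub; rewrite mem_cat !inE eqxx orbT.
      rewrite -{1}[n](swaps_rev (cond_perm d)); apply: map_f; apply: Fsub.
      by rewrite mem_cat !inE eqxx !orbT.
    by rewrite /= !leq_max leqnn orbT.
  - move=> x y /= xF yF xy; have [i iK h] := KP x y xF yF xy.
    by exists i => //; rewrite !leq_max iK !orbT.
  - by move=> t /dD Dt; exists d; split.
pose c_ := fix c_ n := if n is m.+1 then stp (c_ m, m) else c0.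
have c_S n : cond_le (c_ n.+1) (c_ n) by have [] := stpP (c_ n, n).
have c_le n m : n <= m -> cond_le (c_ m) (c_ n).
  elim: m => [|m IH]; first by rewrite leqn0 => /eqP->; exact: cond_le_refl.
  rewrite leq_eqVlt => /orP[/eqP->|/IH h]; first exact: cond_le_refl.
  exact: cond_le_trans h (c_S m).
have c_in n m : n < m -> n \in cond_dom (c_ m).
  move=> nm; have [_ [h _ _] _ _] := stpP (c_ n, n).
  by have [+ _ _ _] := c_le n.+1 m nm; apply.
have c_out n : n \in map (swaps (cond_perm (c_ n.+1))) (cond_dom (c_ n.+1)).
  by have [_ [_ h _] _ _] := stpP (c_ n, n).
have c_K n m : n < m -> n <= cond_level (c_ m).
  move=> nm; have [_ [_ _ h] _ _] := stpP (c_ n, n).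
  by have [_ + _ _] := c_le n.+1 m nm; apply: leq_trans.
have c_sep n x y : x \in cond_dom (c_ n.+1) -> y \in cond_dom (c_ n.+1) -> x <> y ->
  exists2 i, i < cond_level (c_ n.+1) &
  ~ (pred_hat (val (cond_str (c_ n.+1))) i x <-> pred_hat (val (cond_str (c_ n.+1))) i y).
  by have [_ _ + _] := stpP (c_ n, n); apply.
have [A Ain] : exists A : X, forall n,
    agree (val (cond_str (c_ n))) (val A) (cond_dom (c_ n)) (cond_level (c_ n)).
  apply: limit => [n|n m /c_le[]||n|n x y] //.
  - exact: cond_closed.
  - by move=> n; apply: c_in.
  - exact: c_K.
  - exact: c_sep.
(* From stage x+1 on, x is in the domain and its image no longer changes. *)
pose pi x := swaps (cond_perm (c_ x.+1)) x.
pose qi y := swaps (rev (cond_perm (c_ y.+1))) y.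
have piE n : {in cond_dom (c_ n), swaps (cond_perm (c_ n)) =1 pi}.
  move=> x xF; have [_ _ _ e1] := c_le _ _ (leq_maxl n x.+1).
  by have [_ _ _ e2] := c_le _ _ (leq_maxr n x.+1); rewrite e1 // -e2 // c_in.
have qP y : exists2 z, z \in cond_dom (c_ y.+1) & y = pi z /\ qi y = z.
  have /mapP[z zF yz] := c_out y; exists z => //; split; first by rewrite -(piE y.+1).
  by rewrite /qi {2}yz swaps_revK.
have qK : cancel qi pi by move=> y; have [z _ [yz ->]] := qP y.
have pi_inj : injective pi.
  move=> x x'; rewrite -(piE (maxn x x').+1) ?c_in ?ltnS ?leq_maxl //.
  by rewrite -(piE (maxn x x').+1) ?c_in ?ltnS ?leq_maxr // => /swaps_inj.
have pK : cancel pi qi by move=> x; apply: pi_inj; rewrite qK.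
pose A' := mkX (act_hat N_gt0 pK qK (set_mem (valP A))).
have mI n : realizes_image (c_ n) A'.
  by apply: agree_act; [apply: swaps_revK|apply: pK|apply: piE|apply: cond_closed|apply: Ain].
exists A, A'; split.
- exact: act_isomorphic.
- exact: (Ain 0).
- exact: (mI 0).
move=> t; have [_ _ _ /(_ t (pickleK t))[d [Dt c'd dc]]] := stpP (c_ (pickle t), pickle t).
exists d; split=> //.
- exact: cond_le_trans (c_le 0 (pickle t) (leq0n _)) dc.
- have [f k ag _] := c'd; apply: agree_trans ag _.
  exact: agree_sub (Ain (pickle t).+1).
- have [f k ag se] := c'd.
  apply: agree_act; [apply: swaps_revK|apply: pK| |apply: cond_closed|].
    by move=> x xF; rewrite se // (piE (pickle t).+1) // f.
  by apply: agree_trans ag _; apply: agree_sub (Ain (pickle t).+1).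
Qed.

End Fusion.

(** * Meager sets and labels *)

Section Meager.
Context {T : topologicalType}.
Implicit Types (A B M V : set T).

Lemma nowhere_dense_sub A B : A `<=` B -> nowhere_dense B -> nowhere_dense A.
Proof.
move=> AB hB; apply/seteqP; split=> // x.
by rewrite -hB; apply: interiorS; apply: closureS.
Qed.

Lemma meager_sub A B : A `<=` B -> meager B -> meager A.
Proof.
move=> AB [F nF BF]; exists (fun i => F i `&` A).
  by move=> i; apply: nowhere_dense_sub (nF i); apply: subIsetl.
apply/seteqP; split=> [x Ax|x [i _ []]//].
by have := AB x Ax; rewrite BF => -[i _ Fx]; exists i.
Qed.

Lemma meager_bigcup (I : countType) (F : I -> set T) :
  (forall i, meager (F i)) -> meager (\bigcup_i F i).
Proof.
move=> mF.
have /choice[H HP] : forall i, exists H : nat -> set T,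
    (forall j, nowhere_dense (H j)) /\ F i = \bigcup_j H j.
  by move=> i; have [H ? ?] := mF i; exists H.
pose E n := if unpickle n is Some ij then H ij.1 ij.2 else set0.
exists E.
  move=> n; rewrite /E; case: unpickle => [[i j]|]; first by have [h _] := HP i; apply: h.
  by rewrite /nowhere_dense closure0 interior0.
apply/seteqP; split=> [x [i _ Fx]|x [n _]].
  have [_ e] := HP i; move: Fx; rewrite e => -[j _ Hx].
  by exists (pickle (i, j)) => //; rewrite /E pickleK.
rewrite /E; case: unpickle => [[i j]|] // Hx; exists i => //.
by have [_ ->] := HP i; exists j.
Qed.

Lemma meagerU A B : meager A -> meager B -> meager (A `|` B).
Proof.
move=> mA mB; apply: (@meager_sub _ (\bigcup_(b : bool) (if b then A else B))).
  by move=> x [Ax|Bx]; [exists true|exists false].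
by apply: meager_bigcup => -[].
Qed.

Lemma meager_set0 : meager (@set0 T).
Proof.
exists (fun=> set0) => [i|]; first by rewrite /nowhere_dense closure0 interior0.
by apply/seteqP; split=> // x [].
Qed.

Lemma nowhere_dense_meager A : nowhere_dense A -> meager A.
Proof.
by move=> nA; exists (fun=> A) => //; apply/seteqP; split=> [x Ax|x []//]; exists 0.
Qed.

Lemma dense_nbhs V (x : T) B : dense B -> nbhs x V -> exists2 y, V y & B y.
Proof.
move=> dB; rewrite nbhsE => -[W [oW Wx] WV].
by have [|y [/WV Vy By]] := dB W _ oW; [exists x|exists y].
Qed.

Lemma dense_openC A : open A -> dense A -> nowhere_dense (~` A).
Proof.
move=> oA dA; apply/seteqP; split=> // x h.
have cA : closed (~` A) by rewrite closedC.
have [y /cA Ay /Ay] := dense_nbhs dA (h : nbhs x (closure (~` A))).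
by [].
Qed.

Lemma meager_dense_open M : meager M -> exists O : nat -> set T,
  [/\ forall n, open (O n), forall n, dense (O n) &
      forall x, (forall n, O n x) -> ~ M x].
Proof.
move=> [F nF ->]; exists (fun n => ~` closure (F n)); split=> [n|n V [x Vx] oV|x h].
- by apply: closed_openC; apply: closed_closure.
- apply: contrapT => h; have : (closure (F n))° x.
    apply: filterS (open_nbhs_nbhs (conj oV Vx)) => y Vy.
    by apply: contrapT => ny; apply: h; exists y.
  by rewrite nF.
- by move=> [n _ Fx]; apply: (h n); apply: subset_closure.
Qed.

Lemma meager_compl_dense (I : countType) (O : I -> set T) :
  (forall n, open (O n)) -> (forall n, dense (O n)) ->
  meager [set x | ~ forall n, O n x].
Proof.
move=> oO dO; apply: (@meager_sub _ (\bigcup_n ~` O n)).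
  by move=> x /existsNP[n h]; exists n.
by apply: meager_bigcup => n; apply/nowhere_dense_meager/dense_openC.
Qed.
End Meager.

(** * Comparing elements by their labels; the Baire category theorem *)

Section Same.
Context {N : nat}.
Hypothesis N_gt0 : 0 < N.
Notation X := (set_type (@Mod_omega_hat N)).
Implicit Types (A B C : X) (a : N.-tuple nat) (F : seq nat) (K : nat).

Definition same A x B y := forall i, pred_hat (val A) i x <-> pred_hat (val B) i y.

Lemma same_sym A x B y : same A x B y -> same B y A x.
Proof. by move=> h i; apply: iff_sym. Qed.
Lemma same_trans B y A x C z : same A x B y -> same B y C z -> same A x C z.
Proof. by move=> h h' i; apply: iff_trans (h i) (h' i). Qed.
Lemma same_inj A x y : same A x A y -> x = y.
Proof. exact: (hat_sep N_gt0). Qed.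

Lemma iso_bij A B : iso_hat N A B -> exists h : nat -> nat,
  [/\ forall x, same A x B (h x),
      forall i a, h (opS (val A) i a) = opS (val B) i (map_tuple h a) &
      forall j a, relR (val A) j a <-> relR (val B) j (map_tuple h a)].
Proof.
move=> [h [_ hf hr]]; exists h; split.
- move=> x i; have := hr (inr i) [tuple x].
  by rewrite (_ : map_tuple h _ = [tuple h x]) //; apply/val_inj.
- by move=> i a; apply: hf.
- by move=> j a; apply: (hr (inl j)).
Qed.

Lemma iso_same A B x : iso_hat N A B -> exists y, same A x B y.
Proof. by move=> /iso_bij[h [s _ _]]; exists (h x). Qed.

(** An isomorphism preserves labels and labels determine elements, so on [a] it must coincide with
    [h]. *)
Lemma iso_sameS A B i a (h : nat -> nat) : iso_hat N A B ->
  (forall x, x \in a -> same A x B (h x)) ->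
  same A (opS (val A) i a) B (opS (val B) i (map_tuple h a)).
Proof.
move=> /iso_bij[f [s fS _]] ha.
have <- : map_tuple f a = map_tuple h a.
  apply/eq_from_tnth => k; rewrite !tnth_map; apply: (@same_inj B).
  by apply: same_trans (same_sym (s _)) (ha _ (mem_tnth k a)).
by rewrite -fS; apply: s.
Qed.

Lemma iso_sameR A B j a (h : nat -> nat) : iso_hat N A B ->
  (forall x, x \in a -> same A x B (h x)) ->
  relR (val A) j a <-> relR (val B) j (map_tuple h a).
Proof.
move=> /iso_bij[f [s _ fR]] ha.
have <- : map_tuple f a = map_tuple h a.
  apply/eq_from_tnth => k; rewrite !tnth_map; apply: (@same_inj B).
  by apply: same_trans (same_sym (s _)) (ha _ (mem_tnth k a)).
exact: fR.
Qed.

Lemma near_pred A i x :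
  nbhs A [set B : X | pred_hat (val A) i x <-> pred_hat (val B) i x].
Proof.
apply: filterS (near_agree N_gt0 A [:: x] i.+1) => B [_ _ p].
by apply: p; rewrite ?mem_head.
Qed.

(** Generation of x uses finitely many values of operations, which persist near [B]. The elements
    with the stated property contain [S] and are closed under the operations. *)
Lemma near_op_gen B (S : set nat) x : op_gen (val B) S x ->
  exists2 V, nbhs B V & forall B1 B2, V B1 -> V B2 -> iso_hat N B1 B2 ->
    (forall y, S y -> same B1 y B2 y) -> same B1 x B2 x.
Proof.
pose E := [set x | exists2 V, nbhs B V & forall B1 B2, V B1 -> V B2 ->
  iso_hat N B1 B2 -> (forall y, S y -> same B1 y B2 y) -> same B1 x B2 x].
move=> /(_ E); apply.
  by move=> y Sy; exists setT => [|B1 B2 _ _ _]; [apply: filterT|apply].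
move=> i a ha.
have /choice[V VP] : forall y, exists V, y \in a -> nbhs B V /\
    forall B1 B2, V B1 -> V B2 -> iso_hat N B1 B2 ->
    (forall y, S y -> same B1 y B2 y) -> same B1 y B2 y.
  move=> y; case: (boolP (y \in a)) => [/ha[V ? ?]|_]; last by exists set0.
  by exists V.
have n1 : nbhs B [set C : X | forall y, y \in (a : seq nat) -> V y C].
  by apply: nbhs_all => y /VP[].
exists [set C : X | (forall y, y \in a -> V y C) /\ agree (val B) (val C) a 0].
  by apply: filterS2 n1 (near_agree N_gt0 B a 0) => C ? ?; split.
move=> B1 B2 [V1 [s1 _ _]] [V2 [s2 _ _]] iB hS.
have := @iso_sameS B1 B2 i a id iB.
rewrite (_ : map_tuple id a = a); last by apply/val_inj; rewrite /= map_id.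
rewrite -s1 // -s2 //; apply => y ya; have [_ h] := VP y ya.
by apply: h => //; [apply: V1|apply: V2].
Qed.

Lemma nbhs_agree_ext A (V : set X) F0 K0 : nbhs A V ->
  exists F K, [/\ op_closed (val A) F, {subset F0 <= F}, K0 <= K &
    forall B, agree (val A) (val B) F K -> V B].
Proof.
move=> /(nbhs_agree N_gt0)[F1 [K1 [_ FV]]].
have [F Fs cF] := hat_finite N_gt0 A (F0 ++ F1).
exists F, (maxn K0 K1); split=> //.
- by move=> x xF; apply: Fs; rewrite mem_cat xF.
- exact: leq_maxl.
- move=> B AB; apply: FV; apply: agree_sub AB; last exact: leq_maxr.
  by move=> x xF; apply: Fs; rewrite mem_cat xF orbT.
Qed.

Lemma agree_nbhs A B F K : agree (val A) (val B) F K ->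
  nbhs B [set C : X | agree (val A) (val C) F K].
Proof. by move=> AB; apply: filterS (near_agree N_gt0 B F K) => C; apply: agree_trans. Qed.

(** The Baire category theorem below a condition, obtained from [fusion] by ignoring the second
    structure. *)
Lemma baire (T : countType) (V : T -> set X) A F K : op_closed (val A) F ->
  (forall t B H L, op_closed (val B) H -> {subset F <= H} -> K <= L ->
    agree (val A) (val B) F K ->
    exists2 C : X, agree (val B) (val C) H L & nbhs C (V t)) ->
  exists2 B : X, agree (val A) (val B) F K & forall t, V t B.
Proof.
move=> clF dV; pose c0 := @Condition N A F K [::] clF.
(* The premise makes conditions not below [c0] satisfy [D] vacuously, so [D] is dense everywhere. *)
pose D t c := cond_le c c0 -> forall B, realizes c B -> V t B.
have [t c|B [B1 [_ mB _ h]]] := @fusion N N_gt0 T D c0.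
  have [cc0|cc0] := pselect (cond_le c c0); last by exists c; [exact: cond_le_refl|move=> /cc0].
  have [f k ag _] := cc0.
  have [C BC nC] := dV t (cond_str c) (cond_dom c) (cond_level c) (cond_closed (c := c)) f k ag.
  have [H [L [cH sH kL HV]]] := nbhs_agree_ext (cond_dom c) (cond_level c) nC.
  by exists (@Condition N C H L (cond_perm c) cH); [split|move=> _ E; apply: HV].
by exists B => // t; have [c [Dc cc0 mc _]] := h t; apply: Dc.
Qed.

End Same.

(** * Generic rigidity *)

Section Separable.
Context {N : nat}.
Hypothesis N_gt0 : 0 < N.
Notation X := (set_type (@Mod_omega_hat N)).

Lemma Mod_omega_hat_inhabited : inhabited X.
Proof.
pose A : hatstr N := mkstr (fun _ a => head 0 a) (fun j _ => j = 0) (fun=> fun=> True).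
have [|C _] := @realize N N_gt0 A [::] 0; last exact: (inhabits C).
split; last first.
  move=> i a ha; have := ha _ (mem_head_tuple N_gt0 a).
  by rewrite in_nil.
split=> [a _|//|B h _ sB].
- by exists 0; split.
- by case: B sB h => // x B _ /(_ x (mem_head _ _)).
Qed.

(** A countable dense family: one model is chosen for each satisfiable finite list of literals. *)
Lemma separable : exists E : seq (atom (N := N)) -> X, forall (A : X) F K,
  exists e, agree (val A) (val (E e)) F K.
Proof.
have [A0] := Mod_omega_hat_inhabited.
have /choice[E EP] : forall w : seq (atom (N := N)), exists C : X,
    (exists B : X, forall t, t \in w -> holds (val B) t) ->
    forall t, t \in w -> holds (val C) t.
  move=> w; have [[B wB]|h] := pselect (exists B : X,
    forall t, t \in w -> holds (val B) t); first by exists B.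
  by exists A0 => /h.
exists E => A F K; have [w [wA wV]] := nbhs_atoms (near_agree N_gt0 A F K).
by exists w; apply: wV; apply: EP; exists A.
Qed.

Lemma move_away (F H : seq nat) : exists s, forall x, x \in F -> swaps s x \notin H.
Proof.
have [|s sf] := @swaps_extend (fun x => (\max_(y <- H) y).+1 + x) F.
  by move=> x y _ _ /addnI.
exists s => x /sf ->; apply/negP => h.
have : (\max_(y <- H) y).+1 + x <= \max_(y <- H) y by apply: (@leq_bigmax_seq _ H predT id).
by rewrite leqNgt ltnS leq_addr.
Qed.

(** Prepares amalgams over a prescribed part: [F] is placed by [s], and the rest of [E] is shifted
    beyond everything in use. *)
Lemma move_off (F E W : seq nat) (s : seq (nat * nat)) : exists t,
  {in F, swaps t =1 swaps s} /\ forall x, x \in E -> x \notin F -> swaps t x \notin W.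
Proof.
pose m := (\max_(y <- W ++ map (swaps s) F) y).+1.
have mW y : y \in W ++ map (swaps s) F -> y < m.
  by move=> yW; rewrite ltnS; apply: (@leq_bigmax_seq _ _ predT id).
pose f x := if x \in F then swaps s x else m + x.
have [|t tf] := @swaps_extend f (F ++ E).
  move=> x y _ _; rewrite /f; case: ifP => xF; case: ifP => yF.
  - exact: swaps_inj.
  - have := mW (swaps s x); rewrite mem_cat map_f ?orbT // => /(_ isT) h e.
    by rewrite e ltnNge leq_addr in h.
  - have := mW (swaps s y); rewrite mem_cat map_f ?orbT // => /(_ isT) h e.
    by rewrite -e ltnNge leq_addr in h.
  - exact: addnI.
exists t; split=> [x xF|x xE xF].
  by rewrite tf ?mem_cat ?xF // /f xF.
rewrite tf ?mem_cat ?xE ?orbT // /f (negbTE xF); apply/negP => h.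
by have := mW (m + x); rewrite mem_cat h ltnNge leq_addr => /(_ isT).
Qed.

(** Copy i is shifted by i times a strict bound of [F], so the copies lie in disjoint blocks and
    copy 0 stays in place. *)
Lemma disjoint_shifts (k : nat) (F : seq nat) : exists s : 'I_k -> seq (nat * nat),
  (forall i : 'I_k, i = 0 :> nat -> {in F, swaps (s i) =1 id}) /\
  forall i j x, x \in map (swaps (s i)) F -> x \in map (swaps (s j)) F -> i = j.
Proof.
pose m := (\max_(y <- F) y).+1.
have mF y : y \in F -> y < m.
  by move=> yF; rewrite ltnS; apply: (@leq_bigmax_seq _ _ predT id).
have /choice[s sP] : forall i : 'I_k, exists s, {in F, swaps s =1 (fun x => i * m + x)}.
  by move=> i; apply: swaps_extend => x y _ _ /addnI.
exists s; split=> [i i0 x xF|i j x /mapP[y yF ->] /mapP[z zF]]; first by rewrite sP // i0.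
rewrite !sP // => e; apply: val_inj => /=.
have := congr1 (divn^~ m) e.
by rewrite !divnMDl // !divn_small ?mF // !addn0.
Qed.
End Separable.

(** * No generic reduction lowers the arity *)

Section Main.
Context {N M : nat}.
Hypothesis N_gt0 : 0 < N.
Hypothesis M_gt0 : 0 < M.
Hypothesis MN : M < N.
Notation X := (set_type (@Mod_omega_hat N)).
Notation Y := (set_type (@Mod_omega_hat M)).
Variables (g : X -> Y) (U : set X) (O : nat -> set X).
Hypothesis oO : forall n, open (O n).
Hypothesis dO : forall n, dense (O n).
Notation actX := (actX N_gt0).
Implicit Types (A B C : X) (F H : seq nat) (K L : nat) (s : seq (nat * nat)).

(** Invariant under the countable group of permutations [swaps s], so [g] is controlled on all
    translates inside [U]. *)
Definition generic A := forall n s, O n (actX s A).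
Definition dom A := U A /\ generic A.

Hypothesis oU : open U.
Hypothesis U_neq0 : U !=set0.
Hypothesis g_cont : forall A, dom A -> forall V, nbhs (g A) V ->
  nbhs A [set B | dom B -> V (g B)].
Hypothesis g_iso : forall A B, dom A -> dom B ->
  (iso_hat N A B <-> iso_hat M (g A) (g B)).

Lemma generic_actX s A : generic A -> generic (actX s A).
Proof. by move=> gA n t; rewrite -actX_cat; apply: gA. Qed.

Lemma near_O n s B H L : op_closed (val B) H -> exists2 C : X, agree (val B) (val C) H L &
  nbhs C [set C : X | O n (actX s C)].
Proof.
move=> cH.
have nW : nbhs (actX s B) (actX (rev s) @^-1` [set C : X | agree (val B) (val C) H L]).
  by apply: near_actX; rewrite actXK; apply: near_agree.
have [C' WC OC] := dense_nbhs (dO n) nW.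
exists (actX (rev s) C') => //; apply: near_actX; rewrite actKX.
exact: open_nbhs_nbhs.
Qed.

Lemma generic_baire (T : countType) (V : T -> set X) A F K : op_closed (val A) F ->
  (forall t B H L, op_closed (val B) H -> {subset F <= H} -> K <= L ->
    agree (val A) (val B) F K ->
    exists2 C : X, agree (val B) (val C) H L & nbhs C [set C : X | generic C -> V t C]) ->
  exists B : X, [/\ agree (val A) (val B) F K, generic B & forall t, V t B].
Proof.
move=> cF dV.
pose W (t : T + nat * seq (nat * nat)) := match t with
  | inl t => [set C : X | generic C -> V t C]
  | inr (n, s) => [set C : X | O n (actX s C)] end.
have [[t|[n s]] B H L cH FH KL AB|B AB WB] := @baire N N_gt0 _ W A F K cF.
- exact: (dV t B H L).
- exact: near_O.
have gB : generic B by move=> n s; apply: (WB (inr (n, s))).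
by exists B; split=> // t; apply: (WB (inl t)).
Qed.

Lemma generic_exists A F K : op_closed (val A) F ->
  exists2 B : X, agree (val A) (val B) F K & generic B.
Proof.
by move=> cF; have [//|B [? ? _]] := @generic_baire void (fun=> setT) A F K cF; exists B.
Qed.

Definition below_U A F K := forall B, agree (val A) (val B) F K -> U B.

Lemma nbhs_gdiff A B x y : dom A -> dom B -> ~ same (g A) x (g B) y ->
  exists V W, [/\ nbhs A V, nbhs B W &
    forall A' B', V A' -> W B' -> dom A' -> dom B' -> ~ same (g A') x (g B') y].
Proof.
move=> dA dB /existsNP[i hi].
have nA := g_cont dA (near_pred M_gt0 (g A) i x).
have nB := g_cont dB (near_pred M_gt0 (g B) i y).
do 2!eexists; split; [exact: nA|exact: nB|].
by move=> A' B' /= hA hB dA' dB' /(_ i); rewrite -(hA dA') -(hB dB').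
Qed.

Lemma iso_domP A B x : dom A -> dom B -> iso_hat N A B -> exists y, same (g A) x (g B) y.
Proof. by move=> dA dB /(g_iso dA dB)/iso_same. Qed.

(* Otherwise fusion produces an isomorphic pair (A, A') of generic structures such
   that the label of [k] in [g A] is not realized in [g A']. *)
Lemma stable A F K k : op_closed (val A) F -> below_U A F K ->
  exists A1 F1 K1 s l, [/\ [/\ op_closed (val A1) F1, {subset F <= F1}, K <= K1 &
      agree (val A) (val A1) F K], {in F, swaps s =1 id} &
    forall B t, agree (val A1) (val B) F1 K1 -> generic B ->
      {in F1, swaps t =1 swaps s} -> same (g B) k (g (actX t B)) l].
Proof.
move=> clF bU; apply: contrapT => h.
pose c0 := @Condition N A F K [::] clF.
have actF t : (forall x, x \in F -> swaps t x = x) -> forall B,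
    agree (val A) (val B) F K -> agree (val A) (val (actX t B)) F K.
  move=> tF B AB; have := agree_actX N_gt0 (s := [::]) (t := t) _ clF AB.
  rewrite actX_id // map_id; apply => x xF /=; by rewrite tF.
(* Three kinds of requirements: the label of [k] in the first image differs from that of [l] in the
   second, the first structure is generic, and the second is generic. *)
pose D (t : nat + nat * seq (nat * nat) * bool) c := cond_le c c0 -> match t with
  | inl l => forall B B', realizes c B -> realizes_image N_gt0 c B' -> dom B -> dom B' ->
      ~ same (g B) k (g B') l
  | inr (n, s, true) => forall B, realizes c B -> O n (actX s B)
  | inr (n, s, false) => forall B, realizes_image N_gt0 c B -> O n (actX s B)
  end.
have [t c|B [B' [iB mB mB' hc]]] := @fusion N N_gt0 _ D c0.
  have [cc0|] := pselect (cond_le c c0); last by exists c; [exact: cond_le_refl|].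
  have [fc kc agc sc] := cc0.
  case: t => [l|[[n s] []]].
  - have : ~ forall B t,
        agree (val (cond_str c)) (val B) (cond_dom c) (cond_level c) -> generic B ->
        {in cond_dom c, swaps t =1 swaps (cond_perm c)} -> same (g B) k (g (actX t B)) l.
      move=> hl; apply: h; exists (cond_str c), (cond_dom c), (cond_level c).
      exists (cond_perm c), l; split=> //.
        by split=> //; apply: cond_closed.
      by move=> x xF; rewrite -sc.
    (* A failure of stability is open by continuity: a finite part of [B], with [t] prescribed on
       it, forces the two labels apart. *)
    move=> /existsNP[B /existsNP[t /not_implyP[mB /not_implyP[gB /not_implyP[tc ns]]]]].
    have tF x : x \in F -> swaps t x = x by move=> xF; rewrite tc ?fc // -sc.
    have AB : agree (val A) (val B) F K by apply: agree_trans agc _; apply: agree_sub mB.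
    have dB : dom B by split=> //; apply: bU.
    have dB' : dom (actX t B).
      by split; [apply/bU/actF|apply: generic_actX].
    have [V [W [nV nW VW]]] := nbhs_gdiff dB dB' ns.
    have [F1 [K1 [_ FV]]] := nbhs_agree N_gt0 nV.
    have [F2 [K2 [_ FW]]] := nbhs_agree N_gt0 nW.
    have [F3 sF3 cF3] := hat_finite N_gt0 B (cond_dom c ++ F1 ++ map (swaps (rev t)) F2).
    have s1 x : x \in cond_dom c -> x \in F3 by move=> xF; apply: sF3; rewrite mem_cat xF.
    have s2 x : x \in F1 -> x \in F3.
      by move=> xF; apply: sF3; rewrite !mem_cat xF orbT.
    have s3 x : x \in F2 -> x \in map (swaps t) F3.
      move=> xF; rewrite -[x](swaps_rev t); apply/map_f/sF3.
      by rewrite !mem_cat map_f ?orbT.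
    exists (@Condition N B F3 (maxn (cond_level c) (maxn K1 K2)) t cF3).
      by split=> //= [|x xF]; [exact: leq_maxl|rewrite tc].
    move=> _ C C' mC mC'; apply: VW.
      by apply: FV; apply: agree_sub mC => //=; rewrite !leq_max leqnn !orbT.
    by apply: FW; apply: agree_sub mC' => //=; rewrite !leq_max leqnn !orbT.
  - have [C BC nC] := near_O n s (cond_level c) (cond_closed (c := c)).
    have [H [L [cH sH kL HV]]] := nbhs_agree_ext N_gt0 (cond_dom c) (cond_level c) nC.
    by exists (@Condition N C H L (cond_perm c) cH); [split|move=> _ E; apply: HV].
  (* Translating the image by [s] means translating the structure by [s] after the current
     permutation. *)
  - have [C BC nC] := near_O n (s ++ cond_perm c) (cond_level c) (cond_closed (c := c)).
    have [H [L [cH sH kL HV]]] := nbhs_agree_ext N_gt0 (cond_dom c) (cond_level c) nC.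
    exists (@Condition N C H L (cond_perm c) cH); [by split|move=> _ E mE].
    have := HV (actX (rev (cond_perm c)) E) (agree_actX_rev cH mE).
    by rewrite /= actX_cat actKX.
have AB' : agree (val A) (val B') F K.
  have : agree (val (actX [::] A)) (val B') (map (swaps [::]) F) K by [].
  by rewrite actX_id // map_id.
have dB : dom B.
  split; first by apply: bU.
  move=> n s; have [c [Dc cc0 mc _]] := hc (inr (n, s, true)).
  exact: (Dc cc0 B mc).
have dB' : dom B'.
  split; first by apply: bU.
  move=> n s; have [c [Dc cc0 _ mc]] := hc (inr (n, s, false)).
  exact: (Dc cc0 B' mc).
have [l hl] := iso_domP k dB dB' iB.
have [c [Dc cc0 mc mc']] := hc (inl l).
exact: (Dc cc0 B B' mc mc').
Qed.

(** A real is the label of an element, viewed as a subset of omega. *)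
Definition constant_real A F K k := forall B B', agree (val A) (val B) F K ->
  agree (val A) (val B') F K -> generic B -> generic B' -> same (g B) k (g B') k.

(** * The case of locally constant labels *)

Section Constant.
Hypothesis all_const : forall A F K k, op_closed (val A) F -> below_U A F K ->
  exists A' F' K', [/\ op_closed (val A') F', {subset F <= F'}, K <= K',
    agree (val A) (val A') F K & constant_real A' F' K' k].
Variable E : seq (atom (N := N)) -> X.
Hypothesis dE : forall A F K, exists e, agree (val A) (val (E e)) F K.

(** Since [E] is dense, this says that the orbit of [A] under finitely supported permutations is
    dense. *)
Definition universal A := forall e F K, op_closed (val (E e)) F ->
  exists s, agree (val (E e)) (val (actX s A)) F K.

Definition settled A := forall k, nbhs A [set B | generic B -> same (g A) k (g B) k].

Lemma universal_copy A A1 (V : set X) : universal A1 -> nbhs A V -> exists s, V (actX s A1).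
Proof.
move=> uA1 /(nbhs_agree N_gt0)[F [K [cF FV]]]; have [e eA] := dE A F K.
have [s hs] := uA1 e F K (agree_op_closed eA cF).
by exists s; apply: FV; apply: agree_trans eA hs.
Qed.

(** Some translate of [A1] is so close to [A] that continuity gives [V] and settledness gives the
    labels of [g A] on [k]. *)
Lemma settled_copy A A1 (k : seq nat) (V : set X) : dom A -> dom A1 -> settled A ->
  universal A1 -> nbhs A [set B | dom B -> V B] -> exists B, [/\ dom B, iso_hat N B A1, V B &
    forall x, x \in k -> same (g A) x (g B) x].
Proof.
move=> [UA gA] [_ gA1] sA uA1 nV.
have nk : nbhs A [set B : X | forall x, x \in k ->
    [set B : X | generic B -> same (g A) x (g B) x] B].
  by apply: nbhs_all => x _; apply: sA.
have nU : nbhs A U by apply: open_nbhs_nbhs.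
have [s [[h1 h2] h3]] := universal_copy uA1 (filterI (filterI nV nk) nU).
have gB := generic_actX s gA1.
exists (actX s A1); split=> //; last by move=> x /h2; apply.
- exact/isomorphic_sym/iso_actX.
- exact: h1.
Qed.

Lemma settled_reals A A1 x : dom A -> dom A1 -> settled A -> universal A1 ->
  exists y, same (g A) x (g A1) y.
Proof.
move=> dA dA1 sA uA1.
have [|B [dB iB _ hB]] := @settled_copy A A1 [:: x] setT dA dA1 sA uA1.
  by apply: filterS filterT.
have [y hy] := iso_domP x dB dA1 iB; exists y.
by apply: same_trans (hB x (mem_head _ _)) hy.
Qed.

(** Both orbits are dense and labels are locally constant, so both images realize the same labels,
    and matching equal labels is a bijection. Its compatibility with a symbol at one tuple is
    checked in a copy of [A1] close to [A]. *)
Lemma settled_iso A A1 : dom A -> dom A1 -> settled A -> settled A1 ->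
  universal A -> universal A1 -> iso_hat M (g A) (g A1).
Proof.
move=> dA dA1 sA sA1 uA uA1.
have /choice[h hP] x : exists y, same (g A) x (g A1) y by apply: settled_reals.
have /choice[h' hP'] x : exists y, same (g A1) x (g A) y by apply: settled_reals.
have hS i a : h (opS (val (g A)) i a) = opS (val (g A1)) i (map_tuple h a).
  have [|B [dB iB eB hB]] := @settled_copy A A1 (opS (val (g A)) i a :: a)
    [set B | opS (val (g A)) i a = opS (val (g B)) i a] dA dA1 sA uA1.
    apply: g_cont dA [set C : Y | opS (val (g A)) i a = opS (val C) i a] _.
    by apply: filterS (near_agree M_gt0 (g A) a 0) => C [-> //].
  have BA1 x : x \in opS (val (g A)) i a :: a -> same (g B) x (g A1) (h x).
    by move=> /hB/same_sym xB; apply: same_trans xB (hP x).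
  apply: (same_inj M_gt0 (A := g A1)).
  apply: same_trans (same_sym (BA1 _ (mem_head _ _))) _; rewrite eB.
  apply: iso_sameS => //; first exact/(g_iso dB dA1).
  by move=> x xa; apply: BA1; rewrite inE xa orbT.
have hR j a : relR (val (g A)) j a -> relR (val (g A1)) j (map_tuple h a).
  move=> jA.
  have [|B [dB iB eB hB]] := @settled_copy A A1 a
    [set B | relR (val (g B)) j a] dA dA1 sA uA1.
    apply: g_cont dA [set C : Y | relR (val C) j a] _.
    by apply: filterS (near_agree M_gt0 (g A) a 0) => C [_ r _]; apply/r.
  have BA1 x : x \in a -> same (g B) x (g A1) (h x).
    by move=> /hB/same_sym xB; apply: same_trans xB (hP x).
  by apply/(iso_sameR M_gt0 j (proj1 (g_iso dB dA1) iB) BA1).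
exists h; split.
- exists h' => x; apply: (same_inj M_gt0).
    exact: same_trans (same_sym (hP' _)) (same_sym (hP _)).
  exact: same_trans (same_sym (hP _)) (same_sym (hP' _)).
- exact: hS.
- move=> [j|i] a; last first.
    rewrite (tuple1_thead a) (_ : map_tuple h _ = [tuple h (thead a)]); last exact/val_inj.
    exact: (hP (thead a) i).
  split; first exact: hR.
  (* Since the R_j partition the tuples, preservation in one direction suffices. *)
  move=> jA1; have [k [kA _]] := hat_rel M_gt0 (g A) a.
  have jk : j = k := hat_rel_inj M_gt0 jA1 (hR k a kA).
  by rewrite jk.
Qed.

(** A copy of the required part is moved off [H] and amalgamated with [B] over the empty set. *)
Lemma near_universal B H L e F K : op_closed (val B) H -> op_closed (val (E e)) F ->
  exists2 C : X, agree (val B) (val C) H L &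
    nbhs C [set C | exists s, agree (val (E e)) (val (actX s C)) F K].
Proof.
move=> cH cF; have [s sH] := move_away F H.
have dHF x : x \in H -> x \in map (swaps s) F -> False.
  by move=> xH /mapP[y /sH yH xy]; rewrite -xy xH in yH.
have [|C [cC BC EC]] := @amalgam N N_gt0 B (actX s (E e)) H (map (swaps s) F) (maxn L K)
  (leq_ltn_trans M_gt0 MN) cH (op_closed_actX N_gt0 (s := s) cF).
  rewrite (_ : [seq x <- H | _] = [::]).
    split=> [i a ha|j a ha|//]; by have := ha _ (mem_head_tuple N_gt0 a); rewrite in_nil.
  apply/eqP; rewrite -[_ == _]negbK -has_filter; apply/hasPn => x xH.
  by apply/negP; apply: dHF.
exists C; first by apply: agree_sub BC => //; apply: leq_maxl.
have EC' : agree (val (actX s (E e))) (val C) (map (swaps s) F) K.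
  by apply: EC; rewrite ?leq_maxr // => i x _ xF /dHF /(_ xF).
apply: filterS (agree_nbhs N_gt0 EC') => C' h; exists (rev s).
exact: agree_actX_rev.
Qed.

Lemma near_settled A B F K H L k : below_U A F K -> {subset F <= H} -> K <= L ->
  agree (val A) (val B) F K -> op_closed (val B) H ->
  exists2 C : X, agree (val B) (val C) H L & nbhs C [set C | generic C ->
    nbhs C [set D | generic D -> same (g C) k (g D) k]].
Proof.
move=> bU FH KL AB cH.
have [|C [H' [L' [cH' HH' LL' BC cst]]]] := @all_const B H L k cH.
  by move=> D BD; apply: bU; apply: agree_trans AB _; apply: agree_sub BD.
exists C => //; apply: filterS (near_agree N_gt0 C H' L') => C' CC' gC'.
by apply: filterS (agree_nbhs N_gt0 CC') => D CD gD; apply: cst.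
Qed.

(* [H] carries no information on the predicate P_L, which is used to flip a label. *)
Lemma near_not_same A B H L x : op_closed (val B) H ->
  exists2 C : X, agree (val B) (val C) H L & nbhs C [set C | ~ same A x C 0].
Proof.
move=> cH0; have [H' sH cH] := hat_finite N_gt0 B (0 :: H).
pose B' := mkstr (opS (val B)) (relR (val B))
  (fun i y => if (i == L) && (y == 0) then ~ pred_hat (val A) L x else pred_hat (val B) i y).
have pB' : piece B' H' by apply: piece_X cH.
have [C [s r p]] := realize N_gt0 L.+1 pB'.
exists C.
  split=> [i a aH|j a aH|i y iL yH].
  - by rewrite -s // => z /aH zH; apply: sH; rewrite inE zH orbT.
  - by rewrite -r // => z /aH zH; apply: sH; rewrite inE zH orbT.
  - rewrite -p ?pred_mk ?(ltn_eqF iL) //; first exact: ltnW.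
    by apply: sH; rewrite inE yH orbT.
apply: filterS (near_pred N_gt0 C L 0) => C' hC' /(_ L).
have := p L 0 (ltnSn L) (sH _ (mem_head _ _)); rewrite pred_mk !eqxx /=.
by move: hC' => /=; tauto.
Qed.

(** Two generic structures with isomorphic images are built such that the label of 0 in the second
    is not realized in the first; they cannot be isomorphic. *)
Lemma not_all_const : False.
Proof.
have [A0 UA0] := U_neq0.
have [F [K [cF bU]]] := nbhs_agree N_gt0 (open_nbhs_nbhs (conj oU UA0)).
pose T : countType := (seq (atom (N := N)) * seq nat * nat + nat)%type.
pose V (t : T) : set X := match t with
  | inl (e, H, L) => [set C | op_closed (val (E e)) H ->
      exists s, agree (val (E e)) (val (actX s C)) H L]
  | inr k => [set C | nbhs C [set D | generic D -> same (g C) k (g D) k]] end.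
have dV (t : T) B H L : op_closed (val B) H -> {subset F <= H} -> K <= L ->
    agree (val A0) (val B) F K ->
    exists2 C : X, agree (val B) (val C) H L & nbhs C [set C : X | generic C -> V t C].
  move=> cH FH KL AB; case: t => [[[e H1] L1]|k]; last exact: (near_settled k bU FH KL AB cH).
  have [c1|c1] := pselect (op_closed (val (E e)) H1); last first.
    by exists B => //; apply: filterS filterT => C _ _ /c1.
  have [C BC nC] := near_universal L L1 cH c1.
  by exists C => //; apply: filterS nC => C' h _ _; exact: h.
have [A [A0A gA VA]] := generic_baire cF dV.
pose V' (t : T + nat) : set X := match t with
  | inl t => V t
  | inr x => [set C | ~ same A x C 0] end.
have [[t|x] B H L cH FH KL AB|B [A0B gB VB]] := @generic_baire _ V' A0 F K cF.
- exact: dV.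
- have [C BC nC] := near_not_same A L x cH.
  by exists C => //; apply: filterS nC => C' h _; exact: h.
have dA : dom A by split=> //; apply: bU.
have dB : dom B by split=> //; apply: bU.
have iAB : iso_hat M (g A) (g B).
  apply: settled_iso => //.
  - by move=> k; apply: (VA (inr k)).
  - by move=> k; apply: (VB (inl (inr k))).
  - by move=> e H L; apply: (VA (inl (e, H, L))).
  - by move=> e H L; apply: (VB (inl (inl (e, H, L)))).
have /(g_iso dA dB)/isomorphic_sym/(iso_same 0)[x hx] := iAB.
by apply: (VB (inr x)); apply: same_sym.
Qed.
End Constant.

(** * The case of a nowhere constant label *)

(* The element [l] of [g B] is determined by the part of [B] on [F]. *)
Definition fixes_real A F K l := forall B t, agree (val A) (val B) F K -> generic B ->
  {in F, swaps t =1 id} -> same (g B) l (g (actX t B)) l.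

Definition nowhere_constant A F K l := forall A' F' K', op_closed (val A') F' ->
  {subset F <= F'} -> K <= K' -> agree (val A) (val A') F K ->
  ~ constant_real A' F' K' l.

(** By [stable], both [s] and [t ++ s], for [t] fixing the part moved by [s], carry the label of [k]
    to that of [l]. Hence the moved part fixes the label of [l], and nonconstancy is transported
    along [s]. *)
Lemma fixed_nonconstant A F K k : op_closed (val A) F -> below_U A F K ->
  nowhere_constant A F K k -> exists A2 F2 K2 l,
    [/\ op_closed (val A2) F2, below_U A2 F2 K2, fixes_real A2 F2 K2 l &
      nowhere_constant A2 F2 K2 l].
Proof.
move=> cF bU nc.
have [A1 [F1 [K1 [s [l [[cF1 FF1 KK1 AA1] sF st]]]]]] := stable k cF bU.
have back1 B : agree (val (actX s A1)) (val B) (map (swaps s) F1) K1 ->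
    agree (val A1) (val (actX (rev s) B)) F1 K1.
  by move=> h; apply: agree_actX_rev h.
exists (actX s A1), (map (swaps s) F1), K1, l; split.
- exact: op_closed_actX.
- move=> B /back1 AB; apply: bU.
  have AB' : agree (val A) (val (actX (rev s) B)) F K.
    by apply: agree_trans AA1 _; apply: agree_sub AB.
  have := agree_actX N_gt0 (s := [::]) (t := s) _ cF AB'.
  by rewrite actKX actX_id // map_id; apply => x xF; rewrite sF.
- move=> B t AB gB tF; have AB' := back1 B AB.
  have h1 := st _ s AB' (generic_actX (rev s) gB) (fun _ _ => erefl).
  have h2 := st _ (t ++ s) AB' (generic_actX (rev s) gB).
  rewrite actX_cat !actKX in h1 h2.
  apply: same_trans (same_sym h1) (h2 _) => x xF.
  by rewrite swaps_cat tF // map_f.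
- move=> A3 F3 K3 cF3 FF3 KK3 AA3 cst.
  have A13 := back1 A3 AA3.
  have F13 x : x \in F1 -> x \in map (swaps (rev s)) F3.
    by move=> xF; rewrite -[x](swaps_revK s); apply/map_f/FF3/map_f.
  apply: (nc (actX (rev s) A3) (map (swaps (rev s)) F3) K3).
  + exact: op_closed_actX.
  + by move=> x /FF1/F13.
  + exact: leq_trans KK3.
  + by apply: agree_trans AA1 _; apply: agree_sub A13.
  have up B : agree (val (actX (rev s) A3)) (val B) (map (swaps (rev s)) F3) K3 ->
      generic B -> agree (val A3) (val (actX s B)) F3 K3 /\ same (g B) k (g (actX s B)) l.
    move=> h gB; split.
      by have := agree_actX_rev cF3 h; rewrite revK.
    apply: st => //; apply: agree_trans A13 _.
    exact: agree_sub h.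
  move=> B B' /up h /up h' gB gB'.
  have [h1 h2] := h gB; have [h1' h2'] := h' gB'.
  apply: same_trans h2 (same_trans _ (same_sym h2')).
  by apply: cst => //; apply: generic_actX.
Qed.

(** Otherwise, for each t, failure of [Q t] is dense and relatively open below the condition, and
    category yields a generic structure failing all of them. *)
Lemma decide (T : countType) (Q : T -> set X) A F K : op_closed (val A) F ->
  (forall B, agree (val A) (val B) F K -> generic B -> exists t, Q t B) ->
  (forall t B, agree (val A) (val B) F K -> generic B -> ~ Q t B ->
     nbhs B [set C | generic C -> ~ Q t C]) ->
  exists A' F' K' t, [/\ op_closed (val A') F', {subset F <= F'}, K <= K',
    agree (val A) (val A') F K & forall B, agree (val A') (val B) F' K' -> generic B -> Q t B].
Proof.
move=> cF exQ opQ; apply: contrapT => h.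
have [t B H L cH FH KL AB|B [AB gB nQ]] := @generic_baire T (fun t => ~` Q t) A F K cF.
  have /existsNP[C /not_implyP[BC /not_implyP[gC nQ]]] : ~ forall C,
      agree (val B) (val C) H L -> generic C -> Q t C.
    by move=> hQ; apply: h; exists B, H, L, t.
  exists C => //; apply: opQ => //; apply: agree_trans AB _; exact: agree_sub BC.
by have [t Qt] := exQ B AB gB; apply: (nQ t).
Qed.

Lemma no_nowhere_constant A F K l : op_closed (val A) F -> below_U A F K ->
  fixes_real A F K l -> nowhere_constant A F K l -> False.
Proof.
move=> cF bU fixl nc.
(* M < N allows M+1 disjoint copies. Copy 0 stays at [F], which keeps all structures considered in
   [U]. *)
have [sg [sg0 sg_disj]] := disjoint_shifts M.+1 F.
pose Yt t := map (swaps (sg t)) F.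
have [t||A3 [A3Y A3clo]] := @disjoint_copies N N_gt0 M.+1 (fun t => actX (sg t) A) Yt K MN.
- exact: op_closed_actX.
- exact: sg_disj.
pose W (J : pred 'I_M.+1) := flatten [seq Yt j | j <- enum 'I_M.+1 & J j].
have WP J x : x \in W J <-> exists2 t, J t & x \in Yt t.
  split=> [/flattenP[_ /mapP[t + ->]] xt|[t Jt xt]].
    by rewrite mem_filter => /andP[Jt _]; exists t.
  by apply/flattenP; exists (Yt t) => //; apply: map_f; rewrite mem_filter Jt mem_enum.
pose F3 := W predT.
have YF3 t x : x \in Yt t -> x \in F3 by move=> xt; apply/WP; exists t.
have cF3 : op_closed (val A3) F3 by apply: A3clo; apply: WP.
have pull t B : agree (val A3) (val B) F3 K -> agree (val A) (val (actX (rev (sg t)) B)) F K.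
  move=> AB; apply: agree_actX_rev cF _; apply: agree_trans (A3Y t) _.
  by apply: agree_sub AB => // x; apply: YF3.
have bU3 : below_U A3 F3 K.
  move=> B AB; have := agree_actX N_gt0 (s := [::]) (t := sg ord0) _ cF (pull ord0 B AB).
  rewrite actKX actX_id // map_id => h; apply: bU; apply: h => x xF.
  by rewrite sg0.
have pull_dom t B : agree (val A3) (val B) F3 K -> generic B -> dom (actX (rev (sg t)) B).
  by move=> AB gB; split; [apply/bU/pull|apply: generic_actX].
(* Element [k t] of [g B] carries the label of [l] in the image of [B] pulled back along copy t.
   There are countably many candidates [k], so one of them, [kap], is correct throughout a smaller
   basic open set. *)
have [B AB gB|k B AB gB /existsNP[t nt]|A4 [F4 [K4 [kap [cF4 F34 K34 A34 kapP]]]]] :=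
  @decide {ffun 'I_M.+1 -> nat}
   (fun k => [set B | forall t, same (g (actX (rev (sg t)) B)) l (g B) (k t)]) A3 F3 K cF3.
- have dB : dom B by split=> //; apply: bU3.
  have /choice[k kP] t : exists y, same (g (actX (rev (sg t)) B)) l (g B) y.
    by apply: iso_domP => //; [apply: pull_dom|apply/isomorphic_sym/iso_actX].
  by exists (finfun k) => t; rewrite ffunE.
- have dB : dom B by split=> //; apply: bU3.
  have [V [V' [nV nV' VV']]] := nbhs_gdiff (pull_dom t B AB gB) dB nt.
  apply: filterS (filterI (filterI (near_actX nV) nV') (agree_nbhs N_gt0 AB)).
  move=> C [[VC VC'] AC] gC /(_ t).
  by apply: VV' => //; [apply: pull_dom|split=> //; apply: bU3].
have nb3 B H L : {subset F4 <= H} -> K4 <= L -> agree (val A4) (val B) H L ->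
  agree (val A3) (val B) F3 K.
  by move=> FH KL h; apply: agree_trans A34 _; apply: agree_sub h => [x /F34/FH|] //;
    apply: leq_trans KL.
have [B0 AB0 gB0] := generic_exists K4 cF4.
have dB0 : dom B0 by split=> //; apply/bU3/(nb3 B0 F4 K4).
(* (B3) in [g B0] for the M+1 elements [kap t]; if two of them coincide, the dependence is
   trivial. *)
have [i gi] : exists i, op_gen (val (g B0)) [set y | exists2 j, j != i & y = kap j] (kap i).
  have [inj|] := pselect (injective kap); last first.
    move=> /existsNP[i /existsNP[j /not_implyP[eij /eqP ij]]]; exists i => E SE _.
    by apply: SE; exists j; rewrite // eq_sym.
  have [||b /mapP[i _ ->] gb] := hat_gen M_gt0 (g B0) (B := map kap (enum 'I_M.+1)).
  - by rewrite map_inj_uniq ?enum_uniq.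
  - by rewrite size_map size_enum_ord.
  exists i; apply: op_gen_mono gb => y [/mapP[j _ ->] ne]; exists j => //.
  by apply/eqP => ji; apply: ne; rewrite ji.
have [V nV VP] := near_op_gen M_gt0 gi.
have [F5 [K5 [cF5 F45 K45 FV]]] := nbhs_agree_ext N_gt0 F4 K4 (g_cont dB0 nV).
set A5 := B0 in cF5 FV.
have A45 : agree (val A4) (val A5) F4 K4 by [].
have nb4 B : agree (val A5) (val B) F5 K5 -> agree (val A4) (val B) F4 K4.
  by move=> h; apply: agree_trans A45 _; apply: agree_sub h.
have dom5 B : agree (val A5) (val B) F5 K5 -> generic B -> dom B.
  by move=> /nb4 h gB; split=> //; apply/bU3/(nb3 B F4 K4).
have pull5 t B : agree (val A5) (val B) F5 K5 -> agree (val A) (val (actX (rev (sg t)) B)) F K.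
  by move=> /nb4 h; apply: pull; apply: (nb3 B F4 K4).
(* The generation persists near [A5]: in isomorphic structures, equal labels at the other copies
   force equal labels at copy i. *)
have transfer B B' : agree (val A5) (val B) F5 K5 -> agree (val A5) (val B') F5 K5 ->
    generic B -> generic B' -> iso_hat N B B' ->
    (forall j, j != i -> same (g (actX (rev (sg j)) B)) l (g (actX (rev (sg j)) B')) l) ->
    same (g (actX (rev (sg i)) B)) l (g (actX (rev (sg i)) B')) l.
  move=> h h' gB gB' iB hj.
  have kB := kapP B (nb4 B h) gB; have kB' := kapP B' (nb4 B' h') gB'.
  have dB := dom5 B h gB; have dB' := dom5 B' h' gB'.
  apply: same_trans (kB i) (same_trans _ (same_sym (kB' i))).
  apply: VP; [exact: FV|exact: FV|exact/(g_iso dB dB')|].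
  move=> y [j ji ->]; apply: same_trans (same_sym (kB j)) (same_trans (hj j ji) (kB' j)).
have KK5 : K <= K5 by apply: leq_trans K34 K45.
have cY t : op_closed (val A5) (Yt t).
  have := op_closed_actX N_gt0 (s := sg t) (agree_op_closed (pull5 t A5 (agree_refl _ _ _)) cF).
  by rewrite actKX.
have YF5 t x : x \in Yt t -> x \in F5 by move=> /YF3/F34/F45.
pose A6 := actX (rev (sg i)) A5.
have A6A : agree (val A) (val A6) F K by apply: pull5; apply: agree_refl.
(* [th] carries [F] to copy i and the rest of [E] off [F5], so the moved [P] can be amalgamated with
   [A5] over copy i. By [fixl], the label attached to copy i can then be computed after pulling back
   along [th], that is, inside [V0]. *)
have half P E L (V0 : set X) : op_closed (val P) E -> {subset F <= E} -> K5 <= L ->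
    agree (val A6) (val P) F K5 -> (forall B, agree (val P) (val B) E L -> V0 B) ->
    exists th C H, [/\ [/\ op_closed (val C) H, {subset F5 <= H}, {subset map (swaps th) E <= H} &
        forall x, x \in map (swaps th) E -> x \in F5 -> x \in Yt i],
      agree (val A5) (val C) F5 K5, agree (val (actX th P)) (val C) (map (swaps th) E) L &
      forall B, agree (val A5) (val B) F5 K5 ->
        agree (val (actX th P)) (val B) (map (swaps th) E) L -> generic B ->
        V0 (actX (rev th) B) /\
        same (g (actX (rev (sg i)) B)) l (g (actX (rev th) B)) l].
  move=> cE FE KL AP PV.
  have [th [thF th_off]] := move_off F E F5 (sg i).
  have thY x : x \in map (swaps th) E -> x \in F5 -> x \in Yt i.
    move=> /mapP[y yE ->]; have [yF _|yF] := boolP (y \in F); first by rewrite thF // map_f.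
    by rewrite (negbTE (th_off y yE yF)).
  have Y_agree : agree (val A5) (val (actX th P)) (Yt i) K5.
    have := agree_actX N_gt0 (s := sg i) (t := th) _ (agree_op_closed A6A cF) AP.
    by rewrite actKX; apply => x xF; rewrite thF.
  have [|C [cC PC A5C]] := @amalgam N N_gt0 (actX th P) A5 (map (swaps th) E) F5 (maxn L K5)
    (leq_ltn_trans M_gt0 MN) (op_closed_actX N_gt0 (s := th) cE) cF5.
    apply: agree_sub (agree_sym Y_agree) => // x; rewrite mem_filter => /andP[x5 xE].
    exact: thY.
  exists th, C, (map (swaps th) E ++ F5); split.
  - by split=> // x xH; rewrite mem_cat xH ?orbT.
  - apply: A5C; rewrite ?leq_maxr // => m x mK x5 xE; apply: iff_sym.
    by have [_ _ p] := Y_agree; apply: p => //; apply: thY.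
  - by apply: agree_sub PC; rewrite ?leq_maxl.
  - move=> B AB PB gB; split; first by apply/PV/agree_actX_rev.
    have := fixl (actX (rev (sg i)) B) (rev th ++ sg i) (pull5 i B AB)
      (generic_actX _ gB).
    rewrite actX_cat actKX; apply => x xF.
    by rewrite swaps_cat -thF // swaps_revK.
have [P [Q [AP AQ gP gQ nPQ]]] : exists P Q, [/\ agree (val A6) (val P) F K5,
    agree (val A6) (val Q) F K5, generic P, generic Q & ~ same (g P) l (g Q) l].
  have /existsNP[P /existsNP[Q]] := nc A6 F K5 (agree_op_closed A6A cF) (fun _ => id) KK5 A6A.
  by do 4!move=> /not_implyP[?]; move=> ?; exists P, Q; split.
have domA6 B : agree (val A6) (val B) F K5 -> generic B -> dom B.
  by move=> AB gB; split=> //; apply/bU/(agree_trans A6A); apply: agree_sub AB.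
have [VP0 [VQ0 [nP nQ VPQ]]] := nbhs_gdiff (domA6 P AP gP) (domA6 Q AQ gQ) nPQ.
have [EP [LP [cEP FEP KLP PV]]] := nbhs_agree_ext N_gt0 F K5 nP.
have [EQ [LQ [cEQ FEQ KLQ QV]]] := nbhs_agree_ext N_gt0 F K5 nQ.
have [th0 [C0 [H0 [[cH0 FH0 EH0 EF0] A5C0 PC0 real0]]]] := half P EP LP VP0 cEP FEP KLP AP PV.
have [th1 [C1 [H1 [[cH1 FH1 EH1 EF1] A5C1 PC1 real1]]]] := half Q EQ LQ VQ0 cEQ FEQ KLQ AQ QV.
pose c := W (predC1 i).
have cP x : x \in c <-> exists2 j, j != i & x \in Yt j := WP (predC1 i) x.
have cc : op_closed (val A5) c.
  apply: (agree_op_closed (K := 0) _ (A3clo _ _ (WP (predC1 i)))).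
  apply: agree_sub (nb3 A5 F4 K4 _ _ A45) => // x /cP[j _]; exact: YF3.
have cF5' x : x \in c -> x \in F5 by move=> /cP[j _]; apply: YF5.
have cE1 x : x \in map (swaps th1) EQ -> x \in c -> False.
  move=> xE xc; have xi := EF1 x xE (cF5' x xc).
  by move/cP: xc => [j /eqP ji xj]; apply: ji; apply: sg_disj xj xi.
(* [c] is the union of the copies other than i. Moving the rest of [H1] off [H0] leaves an overlap
   inside [c], where both extensions agree with [A5]; their conflict over copy i disappears. *)
have [rho [rhoc rho_off]] := move_off c H1 H0 [::].
have rho_in x : x \in H1 -> swaps rho x \in H0 -> x \in c.
  by move=> x1; apply: contraTT => xc; apply: rho_off.
have A5rho : agree (val A5) (val (actX rho C1)) c K5.
  have A5C1c : agree (val A5) (val C1) c K5 by apply: agree_sub A5C1.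
  have := agree_actX N_gt0 (s := [::]) (t := rho) _ cc A5C1c.
  by rewrite actX_id // map_id; apply => x xc; rewrite rhoc.
have C0rho : agree (val C0) (val (actX rho C1)) c K5.
  by apply: agree_trans (agree_sym _) A5rho; apply: agree_sub A5C0.
have [|C [cC C0C C1C]] := @amalgam N N_gt0 C0 (actX rho C1) H0 (map (swaps rho) H1)
  (maxn LP (maxn LQ K5)) (leq_ltn_trans M_gt0 MN) cH0 (op_closed_actX N_gt0 (s := rho) cH1).
  apply: agree_sub C0rho => // x; rewrite mem_filter => /andP[/mapP[y y1 ->] x0].
  by rewrite rhoc rho_in.
have [B CB gB] := generic_exists (maxn LP (maxn LQ K5)) cC.
(* The label attached to copy i is decided by [P] in [B] and by [Q] in its isomorphic copy [B']. *)
pose B' := actX (rev rho) B.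
have gB' : generic B' by apply: generic_actX.
have C0B : agree (val C0) (val B) H0 (maxn LP (maxn LQ K5)).
  by apply: agree_trans C0C _; apply: agree_sub CB => // x x0; rewrite mem_cat x0.
have C1B E L : {subset E <= H1} -> L <= maxn LP (maxn LQ K5) -> op_closed (val C1) E ->
    (forall m x, m < L -> x \in E -> swaps rho x \in H0 ->
      pred_hat (val C0) m (swaps rho x) <-> pred_hat (val (actX rho C1)) m (swaps rho x)) ->
    agree (val C1) (val B') E L.
  move=> EH LK cE hp; apply: agree_actX_rev cE _.
  have EH' x : x \in map (swaps rho) E -> x \in map (swaps rho) H1.
    by move=> /mapP[y /EH y1 ->]; apply: map_f.
  apply: (agree_trans (C1C _ L EH' LK _)).
    by move=> m _ mL /mapP[x xE ->]; apply: hp.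
  by apply: agree_sub CB => // x /EH' x1; rewrite mem_cat x1 orbT.
have cC1F5 := agree_op_closed A5C1 cF5.
have A5B : agree (val A5) (val B) F5 K5.
  by apply: agree_trans A5C0 _; apply: agree_sub C0B => //; rewrite !leq_max leqnn !orbT.
have A5B' : agree (val A5) (val B') F5 K5.
  apply: agree_trans A5C1 _; apply: C1B => //; first by rewrite !leq_max leqnn !orbT.
  move=> m x mK x5 x0; have xc := rho_in x (FH1 x x5) x0.
  by have [_ _ p] := C0rho; rewrite rhoc //; apply: p.
have PB : agree (val (actX th0 P)) (val B) (map (swaps th0) EP) LP.
  by apply: agree_trans PC0 _; apply: agree_sub C0B => //; rewrite leq_max leqnn.
have QB' : agree (val (actX th1 Q)) (val B') (map (swaps th1) EQ) LQ.
  apply: (agree_trans PC1); apply: C1B => //; first by rewrite !leq_max leqnn !orbT.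
    by apply: agree_op_closed PC1 _; apply: op_closed_actX.
  move=> m x mK xE x0; have := cE1 x xE; case.
  exact: rho_in (EH1 x xE) x0.
have [VB sB] := real0 B A5B PB gB; have [VB' sB'] := real1 B' A5B' QB' gB'.
apply: (VPQ _ _ VB VB').
- apply: domA6; last exact: generic_actX.
  by apply: agree_trans AP _; apply: agree_sub (agree_actX_rev cEP PB).
- apply: domA6; last exact: generic_actX.
  by apply: agree_trans AQ _; apply: agree_sub (agree_actX_rev cEQ QB').
apply: same_trans (same_sym sB) (same_trans _ sB').
apply: transfer => //; first exact: iso_actX.
move=> j ji.
(* [rho] fixes copy j pointwise; conjugated back by [sg j] it fixes [F], so [fixl] applies. *)
have := fixl (actX (rev (sg j)) B) (rev (sg j) ++ rev rho ++ sg j) (pull5 j B A5B)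
  (generic_actX _ gB).
rewrite !actX_cat actKX; apply => x xF.
have xc : swaps (sg j) x \in c by apply/cP; exists j; rewrite // map_f.
have e : swaps rho (swaps (sg j) x) = swaps (sg j) x := rhoc _ xc.
by rewrite !swaps_cat -{1}e swaps_revK swaps_revK.
Qed.

Theorem no_generic_reduction : False.
Proof.
have [h|h] := pselect (exists A F K k, [/\ op_closed (val A) F, below_U A F K &
  nowhere_constant A F K k]).
  move: h => [A [F [K [k [cF bU nc]]]]].
  have [A2 [F2 [K2 [l [? ? ? ?]]]]] := fixed_nonconstant cF bU nc.
  exact: (@no_nowhere_constant A2 F2 K2 l).
have [E dE] := separable N_gt0; apply: (not_all_const _ dE) => A F K k cF bU.
apply: contrapT => nh; apply: h; exists A, F, K, k; split=> // A' F' K' ? ? ? ? ?.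
by apply: nh; exists A', F', K'.
Qed.

End Main.

(** * Inverting a continuous map on a comeager set *)

Section ComeagerContinuity.
Context {M N : nat}.
Hypothesis N_gt0 : 0 < N.
Notation X := (set_type (@Mod_omega_hat M)).
Notation Y := (set_type (@Mod_omega_hat N)).

Lemma open_holds (t : atom (N := N)) : open [set B : Y | holds (val B) t].
Proof. by rewrite openE => B /near_holds. Qed.

Lemma near_not_holds (B : Y) t : ~ holds (val B) t ->
  nbhs B [set C : Y | ~ holds (val C) t].
Proof.
move=> nt; apply: filterS (near_agree N_gt0 B (atom_supp t) (atom_idx t)) => C BC ht.
by apply: nt; apply: agree_holds (agree_sym BC) _ _ ht.
Qed.

(** Each literal has a preimage that is open modulo a meager set. Off the union of these countably
    many errors, preimages of basic open sets are relatively open. *)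
Lemma Baire_measurable_continuous (f : X -> Y) : Baire_measurable f ->
  exists O : nat -> set X, [/\ forall n, open (O n), forall n, dense (O n) &
    forall A, (forall n, O n A) -> forall V, nbhs (f A) V ->
      nbhs A [set B | (forall n, O n B) -> V (f B)]].
Proof.
move=> bf.
have /choice[W WP] : forall t : atom (N := N), exists W : set X, open W /\
    meager (f @^-1` [set B : Y | holds (val B) t] `+` W).
  by move=> t; have [W oW mW] := bf _ (open_holds t); exists W.
have [|O [oO dO OM]] := @meager_dense_open X
    (\bigcup_(t : atom (N := N)) (f @^-1` [set B : Y | holds (val B) t] `+` W t)).
  by apply: meager_bigcup => t; case: (WP t).
exists O; split=> // A OA V /nbhs_atoms[w [wA wV]].
have inW B t : (forall n, O n B) -> W t B <-> holds (val (f B)) t.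
  move=> /OM nB; split=> h; apply: contrapT => nh; apply: nB; exists t => //.
    by right; split.
  by left; split.
have : nbhs A [set B : X | forall t, t \in w -> W t B].
  apply: nbhs_all => t tw; apply: open_nbhs_nbhs; split; first by case: (WP t).
  by apply/inW => //; apply: wA.
by apply: filterS => B hB OB; apply: wV => t tw; apply/inW => //; apply: hB.
Qed.

End ComeagerContinuity.

Lemma not_meager_setT (N : nat) : 0 < N -> ~ meager [set: set_type (@Mod_omega_hat N)].
Proof.
move=> N_gt0 /meager_dense_open[O [oO dO OT]].
have [A] := Mod_omega_hat_inhabited N_gt0.
have [F _ cF] := hat_finite N_gt0 A [::].
have [n B H L cH _ _ _|B _ OB] := @baire N N_gt0 _ O A F 0 cF.
  have [C BC OC] := dense_nbhs (dO n) (near_agree N_gt0 B H L).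
  by exists C => //; apply: open_nbhs_nbhs.
exact: (OT B OB).
Qed.

(** * Sets that are everywhere nonmeager *)

Section EverywhereNonmeager.
Context {T : topologicalType} {I : countType}.
Implicit Types (S V : set T).
Variable base : I -> set T.
Hypothesis base_open : forall i, open (base i).
Hypothesis baseP : forall x V, nbhs x V -> exists2 i, base i x & base i `<=` V.

(* The largest open set in which [S] is everywhere nonmeager. *)
Definition heavy S : set T := ([set x | forall i, base i x -> ~ meager (S `&` base i)])°.

Lemma open_heavy S : open (heavy S). Proof. exact: open_interior. Qed.

Lemma heavy_meet S V : open V -> V `&` heavy S !=set0 -> ~ meager (S `&` V).
Proof.
move=> oV [x [Vx /interior_subset hx]] mSV.
have [i ix iV] := baseP (open_nbhs_nbhs (conj oV Vx)).
by apply: (hx i ix); apply: meager_sub mSV => y [Sy /iV].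
Qed.

(** The points of [S] with a basic neighbourhood where [S] is meager form a meager set. The rest
    lies in a closed set minus its interior, which is nowhere dense. *)
Lemma light_meager S : meager (S `\` heavy S).
Proof.
pose H := [set x | forall i, base i x -> ~ meager (S `&` base i)].
have mH : meager (S `\` H).
  pose F i := [set x | (S `&` base i) x /\ meager (S `&` base i)].
  apply: (@meager_sub _ _ (\bigcup_i F i)).
    move=> x [Sx /existsNP[i /not_implyP[ix /contrapT mi]]].
    by exists i.
  apply: meager_bigcup => i; have [m|nm] := pselect (meager (S `&` base i)).
    by apply: meager_sub m => x [].
  by apply: meager_sub meager_set0 => x [_ /nm].
have cH : closed H.
  rewrite -[H]setCK; apply: open_closedC; rewrite openE => x.
  move=> /existsNP[i /not_implyP[ix mi]].
  apply: filterS (open_nbhs_nbhs (conj (base_open i) ix)) => y iy /(_ i iy).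
  exact.
have nH : nowhere_dense (H `\` H°).
  apply/seteqP; split=> // x hx.
  have cHH : closure (H `\` H°) `<=` H `\` H°.
    apply: closedI => //; apply: open_closedC; exact: open_interior.
  have : H° x by apply: filterS hx => y /cHH[].
  by have /cHH[_] := nbhs_singleton hx.
apply: meager_sub (meagerU mH (nowhere_dense_meager nH)) => x [Sx hx].
by have [Hx|nHx] := pselect (H x); [right|left].
Qed.

Lemma dense_heavyU S : dense (heavy S `|` (~` heavy S)°).
Proof.
move=> V [x Vx] oV; have [[y [Vy hy]]|h] := pselect (V `&` heavy S !=set0).
  by exists y; split=> //; left.
exists x; split=> //; right; apply: filterS (open_nbhs_nbhs (conj oV Vx)) => y Vy hy.
by apply: h; exists y.
Qed.

(** If [V] met [heavy S] but no admissible [heavy (F k)], then [S] would be meager in [V], being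
    covered there by the light parts of the [F k]. *)
Lemma dense_heavy_bigcup S (K : countType) (P : K -> Prop) (F : K -> set T) :
  S `<=` [set x | exists2 k, P k & F k x] ->
  dense ((~` heavy S)° `|` [set x | exists2 k, P k & heavy (F k) x]).
Proof.
move=> SF V [x Vx] oV.
have [hV|h] := pselect (V `&` heavy S !=set0); last first.
  exists x; split=> //; left; apply: filterS (open_nbhs_nbhs (conj oV Vx)) => y Vy hy.
  by apply: h; exists y.
apply: contrapT => nh; apply: (heavy_meet oV hV).
apply: (@meager_sub _ _ (\bigcup_k (F k `\` heavy (F k)))); last first.
  by apply: meager_bigcup => k; apply: light_meager.
move=> y [/SF[k Pk Fy] Vy]; exists k => //; split=> // hy; apply: nh.
by exists y; split=> //; right; exists k.
Qed.

End EverywhereNonmeager.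

(** * A continuous right inverse on a comeager set *)

Section Uniformization.
Context {M N : nat}.
Hypothesis M_gt0 : 0 < M.
Hypothesis N_gt0 : 0 < N.
Notation X := (set_type (@Mod_omega_hat M)).
Notation Y := (set_type (@Mod_omega_hat N)).
Variables (f : X -> Y) (O : nat -> set X).
Hypothesis oO : forall n, open (O n).
Hypothesis f_cont : forall A, (forall n, O n A) -> forall V, nbhs (f A) V ->
  nbhs A [set B | (forall n, O n B) -> V (f B)].
Hypothesis f_nonmeager : ~ meager (f @` [set A | forall n, O n A]).

Variable E : seq (atom (N := M)) -> X.
Hypothesis dE : forall (A : X) F K, exists e, agree (val A) (val (E e)) F K.

(** Countably many names of basic open sets: an index into the dense family, a finite domain and a
    bound for the predicates. *)
Let code : countType := (seq (atom (N := M)) * seq nat * nat)%type.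
Implicit Types (c d : code) (n : nat) (A : X) (B : Y).

Let rep c : X := E c.1.1.
Let cyl c : set X := [set A | agree (val (rep c)) (val A) c.1.2 c.2].
Let valid c := op_closed (val (rep c)) c.1.2.
Let img c : set Y := f @` [set A | (forall n, O n A) /\ cyl c A].

(** Domain, level and separation are as [limit] demands; the last clause puts the limit into
    [O n]. *)
Let refines n c d : Prop :=
  [/\ [/\ valid d, {subset c.1.2 <= d.1.2}, c.2 <= d.2 &
     agree (val (rep c)) (val (rep d)) c.1.2 c.2],
   n \in d.1.2, n <= d.2,
   (forall x y, x \in d.1.2 -> y \in d.1.2 -> x <> y -> exists2 i, i < d.2 &
      ~ (pred_hat (val (rep d)) i x <-> pred_hat (val (rep d)) i y)) &
   cyl d `<=` O n].

Let exists_refinement n c A : valid c -> (forall n, O n A) -> cyl c A ->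
  exists2 d, refines n c d & cyl d A.
Proof.
move=> vc OA cA.
have [F [K [cF sF KK FO]]] := nbhs_agree_ext M_gt0 (n :: c.1.2) (maxn n c.2)
  (open_nbhs_nbhs (conj (oO n) (OA n))).
have [K' sepK] := separating_bound M_gt0 A F.
have [e eA] := dE A F (maxn K K').
exists (e, F, maxn K K'); last exact: agree_sym.
have cF' x : x \in c.1.2 -> x \in F by move=> xc; apply: sF; rewrite inE xc orbT.
have cK : c.2 <= maxn K K'.
  by apply: leq_trans (leq_maxr n c.2) (leq_trans KK (leq_maxl _ _)).
split.
- split=> //; first exact: agree_op_closed eA cF.
  by apply: agree_trans cA _; apply: agree_sub eA.
- by apply: sF; rewrite mem_head.
- by apply: leq_trans (leq_maxl n c.2) (leq_trans KK (leq_maxl _ _)).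
- move=> x y xF yF xy; have [i iK h] := sepK x y xF yF xy.
  have iKK : i < maxn K K' by rewrite leq_max iK orbT.
  by exists i => //; have [_ _ p] := eA; rewrite /= -!p.
- move=> B eB; apply: FO; apply: agree_trans (agree_sub _ _ eA) (agree_sub _ _ eB) => //;
  exact: leq_maxl.
Qed.

Let base (w : seq (atom (N := N))) : set Y := [set B | forall t, t \in w -> holds (val B) t].

Let base_open w : open (base w).
Proof.
by rewrite openE => B hB; apply: nbhs_all => t tw; apply/near_holds/hB.
Qed.

Let baseP (B : Y) V : nbhs B V -> exists2 w, base w B & base w `<=` V.
Proof. by move=> /nbhs_atoms[w [wB wV]]; exists w. Qed.

Let hv c := heavy base (img c).

(** On [decided c] membership in [hv c] is locally constant; on [shrinks n c] a point of [hv c] also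
    lies in [hv d] for some refinement [d]. *)
Let decided c : set Y := hv c `|` (~` hv c)°.
Let shrinks n c : set Y := (~` hv c)° `|` [set B | exists2 d, refines n c d & hv d B].

Let open_hv c : open (hv c). Proof. exact: open_heavy. Qed.

Let open_decided c : open (decided c).
Proof. by apply: openU => //; apply: open_interior. Qed.

Let dense_decided c : dense (decided c). Proof. exact: dense_heavyU. Qed.

Let open_shrinks n c : open (shrinks n c).
Proof.
apply: openU; first exact: open_interior.
rewrite openE => B [d rd hB]; apply: filterS (open_nbhs_nbhs (conj (open_hv d) hB)).
by move=> C hC; exists d.
Qed.

Let dense_shrinks n c : valid c -> dense (shrinks n c).
Proof.
move=> vc; apply: (dense_heavy_bigcup base_open baseP).
move=> _ [A [OA cA] <-]; have [d rd dA] := @exists_refinement n c A vc OA cA.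
by exists d => //; exists A.
Qed.

Let start : exists c, valid c /\ hv c !=set0.
Proof.
apply: contrapT => h; apply: f_nonmeager.
apply: (@meager_sub _ _ (\bigcup_c [set B | valid c /\ (img c `\` hv c) B])).
  move=> _ [A OA <-]; have [F _ cF] := hat_finite M_gt0 A [::].
  have [e eA] := dE A F 0.
  have ve : valid (e, F, 0) by apply: agree_op_closed eA cF.
  exists (e, F, 0) => //; split=> //; split; first by exists A => //; split=> //; apply: agree_sym.
  by move=> hA; apply: h; exists (e, F, 0); split=> //; exists (f A).
apply: meager_bigcup => c; apply: meager_sub (light_meager base_open (img c)).
by move=> x [].
Qed.

Let choices n c B : set nat :=
  [set k | exists d, [/\ unpickle k = Some d, refines n c d & hv d B]].

(* Taking the least code makes the choice locally constant, hence the inverse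
   continuous. *)
Let next n c B : code :=
  match pselect (exists k, `[< choices n c B k >]) with
  | left ex => odflt c (unpickle (ex_minn ex))
  | right _ => c
  end.

Let nextP n c B : shrinks n c B -> hv c B -> refines n c (next n c B) /\ hv (next n c B) B.
Proof.
move=> [h|[d rd hd]] hc; first by have /(_ hc) := nbhs_singleton h.
rewrite /next; case: pselect => [ex|[]]; last first.
  by exists (pickle d); apply/asboolP; exists d; rewrite pickleK.
by case: ex_minnP => k /asboolP[d' [-> ? ?]] _.
Qed.

(** The least code is settled by the finitely many codes up to it, and at a decided point each of
    these is locally in or out of [choices]. *)
Let near_next n c B : (forall d, decided d B) -> shrinks n c B -> hv c B ->
  nbhs B [set C | next n c C = next n c B].
Proof.
move=> dec shr hc.
have ex : exists k, `[< choices n c B k >].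
  have [rn hn] := nextP shr hc.
  by exists (pickle (next n c B)); apply/asboolP; exists (next n c B); rewrite pickleK.
have near_eq k : nbhs B [set C | choices n c C k <-> choices n c B k].
  case uk: (unpickle k) => [d|]; last first.
    by apply: filterS filterT => C _; split=> -[d []]; rewrite uk.
  have [hd|hd] := dec d.
    apply: filterS (open_nbhs_nbhs (conj (open_hv d) hd)) => C hC.
    by split=> -[d' []]; rewrite uk => -[<-] rd _; exists d.
  have hB := nbhs_singleton hd; apply: filterS hd => C hC.
  by split=> -[d' []]; rewrite uk => -[<-].
have := @nbhs_all Y nat B (iota 0 (ex_minn ex).+1) _ (fun k _ => near_eq k).
apply: filterS => C hC; rewrite /next /mkset.
case: ex_minnP hC => k /asboolP kB kmin hC.
have {}hC j : j <= k -> choices n c C j <-> choices n c B j.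
  by move=> jk; apply: (hC j); rewrite mem_iota add0n ltnS.
have kC : choices n c C k by apply/hC.
case: pselect => [ex1|[]]; last by exists k; apply/asboolP.
case: pselect => [ex2|//].
have e2 : ex_minn ex2 = k.
  case: ex_minnP => k' /asboolP k'B k'min; apply/eqP; rewrite eqn_leq.
  by rewrite k'min ?kmin //; apply/asboolP.
have e1 : ex_minn ex1 = k.
  case: ex_minnP => k' /asboolP k'C k'min.
  have k'k : k' <= k by apply/k'min/asboolP.
  by apply/eqP; rewrite eqn_leq k'k kmin //; apply/asboolP/hC.
by rewrite e1 e2.
Qed.

(** Starting from a cylinder with heavy image, ever smaller cylinders whose images are heavy at [B]
    are chosen; [g B] is a common point of them. The dense open sets [H n] make each choice possible
    and locally constant. *)
Theorem uniformization : exists (g : Y -> X) (U : set Y) (H : nat -> set Y),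
  [/\ open U, U !=set0, forall n, open (H n), forall n, dense (H n) &
    forall B, U B -> (forall n, H n B) -> f (g B) = B /\
      forall V, nbhs (g B) V ->
        nbhs B [set C | U C -> (forall n, H n C) -> V (g C)]].
Proof.
have [c0 [vc0 hc0]] := start.
pose good B := [/\ hv c0 B, forall d, decided d B & forall n d, valid d -> shrinks n d B].
pose sq B := fix sq n := if n is m.+1 then next m (sq m) B else c0.
have sqP B n : good B -> [/\ valid (sq B n), hv (sq B n) B &
    refines n (sq B n) (sq B n.+1)].
  move=> [h0 dec shr]; elim: n => [|n [v h r]].
    by split=> //=; have [] := nextP (shr 0 c0 vc0) h0.
  have [[v' _ _ _] _ _ _ _] := r.
  have [_ h'] := nextP (shr n _ v) h.
  by split=> //; have [] := nextP (shr n.+1 _ v') h'.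
have sq_mono B n k : good B -> n <= k -> [/\ {subset (sq B n).1.2 <= (sq B k).1.2},
    (sq B n).2 <= (sq B k).2 &
    agree (val (rep (sq B n))) (val (rep (sq B k))) (sq B n).1.2 (sq B n).2].
  move=> gB; elim: k => [|k IH]; first by rewrite leqn0 => /eqP->; split.
  rewrite leq_eqVlt => /orP[/eqP->|/IH[s1 k1 a1]]; first by split.
  have [_ _ [[_ s2 k2 a2] _ _ _ _]] := sqP B k gB; split.
  - by move=> x /s1/s2.
  - exact: leq_trans k2.
  - by apply: agree_trans a1 _; apply: agree_sub a2.
have [A0] := Mod_omega_hat_inhabited M_gt0.
have /choice[g gP] : forall B, exists A, good B -> forall n, cyl (sq B n) A.
  move=> B; have [gB|nB] := pselect (good B); last by exists A0.
  have [n|n k nk|n|n|n x y|A hA] := @limit M M_gt0 (fun n => rep (sq B n))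
    (fun n => (sq B n).1.2) (fun n => (sq B n).2).
  - by have [] := sqP B n gB.
  - exact: sq_mono.
  - by have [_ _ []] := sqP B n gB.
  - by have [_ _ []] := sqP B n gB.
  - by have [_ _ [_ _ _ h _]] := sqP B n gB; apply: h.
  - by exists A.
have small B (F : seq nat) K : good B -> exists n, {subset F <= (sq B n).1.2} /\ K <= (sq B n).2.
  move=> gB; exists (maxn (\max_(x <- F) x) K).+1; split.
    move=> x xF; have xm : x <= maxn (\max_(x <- F) x) K.
      by rewrite leq_max (@leq_bigmax_seq _ _ predT id).
    have [s _ _] := sq_mono B x.+1 _ gB (xm : x.+1 <= (maxn (\max_(x <- F) x) K).+1).
    by apply: s; have [_ _ []] := sqP B x gB.
  have [_ _ [_ _ h _ _]] := sqP B (maxn (\max_(x <- F) x) K) gB.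
  by apply: leq_trans h; apply: leq_maxr.
pose H n : set Y := match unpickle n : option (code + nat * code) with
  | Some (inl d) => decided d
  | Some (inr (n, d)) => [set B | valid d -> shrinks n d B]
  | None => setT end.
have HP B : hv c0 B -> (forall n, H n B) -> good B.
  move=> h0 HB; split=> // [d|n d].
    by have := HB (pickle (inl d : code + nat * code)); rewrite /H pickleK.
  by have := HB (pickle (inr (n, d) : code + nat * code)); rewrite /H pickleK.
exists g, (hv c0), H; split=> //.
- move=> n; rewrite /H; case: unpickle => [[d|[k d]]|]; [exact: open_decided| |exact: openT].
  have [v|v] := pselect (valid d).
    rewrite (_ : [set _ | _] = shrinks k d); first exact: open_shrinks.
    by apply/seteqP; split=> x h; [exact: h|move=> _].
  by rewrite (_ : [set _ | _] = setT); [exact: openT|apply/seteqP; split=> // x _ /v].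
- move=> n; rewrite /H; case: unpickle => [[d|[k d]]|]; first exact: dense_decided.
    have [v|v] := pselect (valid d).
      rewrite (_ : [set _ | _] = shrinks k d); first exact: dense_shrinks.
      by apply/seteqP; split=> x h; [exact: h|move=> _].
    by move=> V [x Vx] _; exists x; split=> // /v.
  by move=> V [x Vx] _; exists x.
move=> B h0 HB; have gB := HP B h0 HB.
have OgB n : O n (g B) by have [_ _ [_ _ _ _]] := sqP B n gB; apply; apply: gP.
split.
  (* Otherwise continuity gives a small cylinder around [g B] whose image misses a neighbourhood of
     [B], although this image is heavy at [B]. *)
  apply: contrapT => ne.
  have [t tf tB] : exists2 t, holds (val (f (g B))) t & ~ holds (val B) t.
    apply: contrapT => nt; apply: ne; apply/val_inj/hatstr_ext => [i a|j a|i x].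
    - apply: contrapT => h; apply: nt; exists (inl (inl (i, a, opS (val (f (g B))) i a))) => //.
      by move=> /= e; apply: h.
    - split=> h; apply: contrapT => h'; apply: nt.
        by exists (inl (inr (true, j, a))).
      by exists (inl (inr (false, j, a))) => //=; tauto.
    - split=> h; apply: contrapT => h'; apply: nt.
        by exists (inr (true, i, x)).
      by exists (inr (false, i, x)) => //=; tauto.
  have [F [K [_ FV]]] := nbhs_agree M_gt0 (f_cont OgB (near_holds tf)).
  have [n [sF sK]] := small B F K gB; have [_ hn _] := sqP B n gB.
  have := near_not_holds N_gt0 tB; rewrite nbhsE => -[V [oV VB] Vt].
  apply: (heavy_meet baseP oV (S := img (sq B n))); first by exists B.
  apply: meager_sub meager_set0 => _ [[A [OA cA] <-] /Vt]; apply.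
  apply: FV => //; have := gP B gB n => cg.
  apply: agree_sub sF sK _; exact: agree_trans (agree_sym cg) cA.
move=> V /(nbhs_agree M_gt0)[F [K [_ FV]]].
have [n [sF sK]] := small B F K gB.
(* The code reached at stage n is locally constant and determines [g B] on [F] below level [K]. *)
have : nbhs B [set C | sq C n = sq B n].
  elim: n {sF sK} => [|n IH]; first by apply: filterS filterT.
  have [v h _] := sqP B n gB; have [_ dec shr] := gB.
  apply: filterS2 IH (near_next dec (shr n _ v) h) => C e1 e2 /=.
  by rewrite e1.
apply: filterS => C eC hC HC; have gC := HP C hC HC.
apply: FV; apply: agree_sub sF sK _.
apply: agree_trans (agree_sym (gP B gB n)) _.
by rewrite -eC; apply: gP.
Qed.

End Uniformization.

(** * Reduction of both cases to the generic statement *)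

Theorem corollary11 (m n : nat) (hm : 1 <= m) (hn : 1 <= n) (hmn : m <> n) :
  ~ exists f : Mod_omega_hat m -> Mod_omega_hat n,
      star_reduction (iso_hat m) (iso_hat n) f.
Proof.
move=> [f [f_meas f_cat f_iso]].
have [O [oO dO f_cont]] := Baire_measurable_continuous f_meas.
have [mn|nm|//] := ltngtP m n; last first.
  apply: (@no_generic_reduction m n hm hn nm f setT O oO dO openT).
  - by have [A] := Mod_omega_hat_inhabited hm; exists A.
  - have sub A : dom hm setT O A -> forall k, O k A.
      by move=> [_ gA] k; rewrite -[A](@actX_id m hm [::]) //; apply: gA.
    move=> A /sub OA V nV; apply: filterS (f_cont A OA V nV) => B h /sub; exact: h.
  - by move=> A B _ _; apply: f_iso.
(* If the image were meager, category preservation would make a comeager subset of the domain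
   meager, against the Baire category theorem. *)
have nm : ~ meager (f @` [set A | forall k, O k A]).
  move=> /f_cat mf; apply: (not_meager_setT hm).
  apply: meager_sub (meagerU mf (meager_compl_dense oO dO)) => A _.
  have [OA|nA] := pselect (forall k, O k A); [left|right] => //.
  by exists A.
have [E dE] := separable hm.
have [g [U [H [oU U0 oH dH gP]]]] := uniformization hm hn oO f_cont nm dE.
have sub A : dom hn U H A -> U A /\ forall k, H k A.
  by move=> [UA gA]; split=> // k; rewrite -[A](@actX_id n hn [::]) //; apply: gA.
apply: (@no_generic_reduction n m hn hm mn g U H oH dH oU U0).
- move=> A /sub[UA HA] V nV; have [_ cg] := gP A UA HA.
  by apply: filterS (cg V nV) => B h /sub[UB HB]; apply: h.
(* [g] is a right inverse of [f], so the equivalence for [f] read backwards makes [g] a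
   reduction. *)
- move=> A B /sub[UA HA] /sub[UB HB].
  have [fA _] := gP A UA HA; have [fB _] := gP B UB HB.
  by rewrite -{1}fA -{1}fB; apply: iff_sym; apply: f_iso.
Qed.
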